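(* The bounded convex sets $\mathcal K\subseteq\mathbb R^d$ and sparsities $s\in[d]$ listed below yield the following gains $\mathrm{gain}(\mathcal K,s)$ (defined in the context). Here $\mathrm{gain}=\widetilde\Omega(g)$ means that the gain is bounded below by $g$ up to a constant factor, with lower order terms in the dimension $d$ omitted. The bounds for arbitrary sparsity are stated for $s\ge3$. (1) Probability simplex $\mathbf{\Delta}_d=\{x\in\mathbb R^d:x\ge0,\ \sum_ix_i=1\}$. For arbitrary $s$: $\mathrm{gain}=\widetilde\Omega\Big(\frac{\min\{\sqrt s,\sqrt{\ln d}\}}{\ln s}\Big)$. For $s=\lfloor\ln d\rfloor$: $\mathrm{gain}=\widetilde\Omega(\sqrt{\ln d})$. (2) $L_p$ norm ball $\{x\in\mathbb R^d:\sum_i|x_i|^p\le1\}$, $p\in[1,2]$. For arbitrary $s$: $\mathrm{gain}=\widetilde\Omega\Big(\frac{\min\{\sqrt s,\,d^{1-1/p}\}}{s^{1-1/p}}\Big)$. For $p=4/3$ and $s=\lfloor\sqrt d\rfloor$: $\mathrm{gain}=\widetilde\Omega(d^{1/8})$. (3) Axis-aligned ellipsoid $\{x\in\mathbb R^d:\sum_ix_i^2/w_i^2\le1\}$, $w\in\mathbb R_{>0}^d$ with $w_1\ge\dots\ge w_d$. For arbitrary $s$: $\mathrm{gain}=\widetilde\Omega\Big(\frac{\min\{w_1\sqrt s,\,\|w\|_2\}}{\|w_{\le s}\|_2}\Big)$. For $w_1\asymp d^{-1/4}$, $w_j\asymp d^{-1/2}$ ($j\ge2$) and $s=\lfloor\sqrt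 d\rfloor$: $\mathrm{gain}=\widetilde\Omega(d^{1/4})$. (4) Box $\{x\in\mathbb R^d:|x_i|\le w_i\ \forall i\}$, $w\in\mathbb R_{>0}^d$ with $w_1\ge\dots\ge w_d$. For arbitrary $s$: $\mathrm{gain}=\widetilde\Omega\Big(\frac{\min\{\|w\|_2\sqrt s,\,\|w\|_1\}}{\|w_{\le s}\|_1+\sqrt s\,\|w_{>s}\|_2}\Big)$. For $w_1\asymp d^{-1/4}$, $w_j\asymp d^{-1}$ ($j\ge2$) and $s=\lfloor\sqrt d\rfloor$: $\mathrm{gain}=\widetilde\Omega(d^{1/4})$. (5) Sum of $L_1$ and $L_\infty$ balls $\alpha_1B_1+\alpha_\infty B_\infty$, $\alpha_1,\alpha_\infty>0$. For arbitrary $s$: $\mathrm{gain}=\widetilde\Omega\Big(\frac{\min\{(\alpha_1+\alpha_\infty\sqrt d)\sqrt s,\ \alpha_1+\alpha_\infty d\}}{\alpha_1+\alpha_\infty\sqrt{sd}}\Big)$. For $\alpha_1\asymp d^{-1/4}$, $\alpha_\infty\asymp d^{-1}$ and $s=\lfloor\sqrt d\rfloor$: $\mathrm{gain}=\widetilde\Omega(d^{1/4})$. (6) Sum of $L_1$ and $L_2$ balls $\alpha_1B_1+\alpha_2B_2$, $\alpha_1,\alpha_2>0$. For arbitrary $s$: $\mathrm{gain}=\widetilde\Omega\Big(\frac{\min\{(\alpha_1+\alpha_2)\sqrt s,\ \alpha_1+\alpha_2\sqrt d\}}{\alpha_1+\alpha_2\sqrt s}\Big)$. For $\alpha_1\asymp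 d^{-1/4}$, $\alpha_2\asymp d^{-1/2}$ and $s=\lfloor\sqrt d\rfloor$: $\mathrm{gain}=\widetilde\Omega(d^{1/4})$. (7) Segment plus $L_2$ ball $\alpha_0[-\mathbf e_1,\mathbf e_1]+\alpha_2B_2$, $\alpha_0,\alpha_2>0$. For arbitrary $s$: $\mathrm{gain}=\widetilde\Omega\Big(\frac{\min\{(\alpha_0+\alpha_2)\sqrt s,\ \alpha_0+\alpha_2\sqrt d\}}{\alpha_0+\alpha_2\sqrt s}\Big)$. For $\alpha_0\asymp d^{-1/4}$, $\alpha_2\asymp d^{-1/2}$ and $s=\lfloor\sqrt d\rfloor$: $\mathrm{gain}=\widetilde\Omega(d^{1/4})$. In particular, online mirror descent with an appropriate block norm achieves a regret upper bound within a factor $\widetilde O(d^{-1/4})$ of the corresponding upper bounds for both online projected gradient descent (Euclidean geometry) and online exponentiated gradient (entropic geometry), for certain families of convex sets $\mathcal K_d\subseteq\mathbb R^d$ and corresponding sparsities $s_d\in[d]$.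
   Context: Notation: $[d]=\{1,\dots,d\}$. $B_p=\{x\in\mathbb R^d:\|x\|_p\le1\}$; $[-\mathbf e_1,\mathbf e_1]$ is the segment joining $-\mathbf e_1$ and $\mathbf e_1$; sums of sets are Minkowski sums. For $w_1\ge\dots\ge w_d$, $w_{\le s}$ contains the largest $s$ entries and $w_{>s}$ the remaining entries. $a\asymp b$ means equality up to positive constant factors. $\widetilde\Omega$ and $\widetilde O$ omit lower order terms in $d$. Block norms. For a partition $\mathcal B=\{B_1,\dots,B_n\}$ of $[d]$ into $n$ nonempty blocks, $\|x\|_{[\mathcal B]}=\sum_{j=1}^n\|x_{B_j}\|_2$, where $x_{B_j}$ is the restriction of $x$ to the coordinates in $B_j$; the dual norm is $\|g\|^*_{[\mathcal B]}=\max_j\|g_{B_j}\|_2$. The partition is equal-size if block sizes differ by at most $1$. Put $(\gamma_1,p_1)=(1,2)$, $(\gamma_2,p_2)=(\tfrac12,2)$, and $\gamma_n=\frac1{e\ln n}$, $p_n=1+\frac1{\ln n}$ for $n\ge3$. Define $h_{\mathcal B}(x)=\frac1{\gamma_np_n}\sum_{j=1}^n\|x_{B_j}\|_2^{p_n}$ and, for $\rho>0$, $h_{\mathcal B,\rho}(x)=\rho^2h_{\mathcal B}(x/\rho)$. For differentiable $h$, $B_h(x\|y)=h(x)-h(y)-\langle\nabla h(y),x-y\rangle$. For bounded convex $\mathcal K\subseteq\mathbb R^d$, $\rho_n(\mathcal K)=\max_{\mathcal B}\sup_{x\in\mathcal K}\|x\|_{[\mathcal B]}$, the maximum over equal-size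 $n$-partitions. With $\mathcal B$ a uniformly random equal-size $n$-partition and $x^{(1)}\in\mathcal K$ a fixed starting point (independent of $\mathcal B$), define $D_n(\mathcal K)=\big(\mathbb E_{\mathcal B}\big[\max_{z\in\mathcal K}B_{h_{\mathcal B,\rho_n(\mathcal K)}}(z\|x^{(1)})\big]\big)^{1/2}$, and $G_n(s)=\sup\{(\mathbb E_{\mathcal B}[(\|c\|^*_{[\mathcal B]})^2])^{1/2}:c\in[-1,1]^d,\ |\mathrm{supp}(c)|\le s\}$. The starting point is $x^{(1)}=\frac1d\mathbf 1_d$ for the simplex, and any fixed point of $\mathcal K$ for the other bodies. The quantity $2D_n(\mathcal K)G_n(s)\sqrt T$ is the regret upper bound, over horizon $T$, of online mirror descent with the $n$-th random block norm for losses with $s$-sparse gradients in $[-1,1]^d$; $n=1$ is the Euclidean geometry (online projected gradient descent) and $n=d$ is the entropic geometry ($L_1$ norm; identified with online exponentiated gradient). The gain of block norms is $$\mathrm{gain}(\mathcal K,s)=\frac{\min\{D_1(\mathcal K)G_1(s),\,D_d(\mathcal K)G_d(s)\}}{\min_{1\le n\le d}D_n(\mathcal K)G_n(s)}.$$ *)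

(* Defs.v *)
From HB Require Import structures.
From mathcomp Require Export all_boot all_order all_algebra.
From mathcomp Require Export all_classical all_reals all_analysis.

Set Implicit Arguments.
Unset Strict Implicit.
Unset Printing Implicit Defensive.
Export Order.TTheory GRing.Theory Num.Theory.
Export numFieldNormedType.Exports.

Local Open Scope classical_set_scope.
Local Open Scope ring_scope.

Section Norms.
Context {R : realType} {d : nat}.
Implicit Types (x y g : 'rV[R]_d) (A : {set 'I_d}) (P : {set {set 'I_d}}).

Definition l1norm x : R := \sum_i `|x ord0 i|.
Definition l2norm x : R := Num.sqrt (\sum_i x ord0 i ^+ 2).
Definition linfnorm x : R := \big[Num.max/0]_i `|x ord0 i|.
Definition dotprod x y : R := \sum_i x ord0 i * y ord0 i.

(* The Euclidean norm of the restriction of x to the coordinates in A. *)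
Definition l2norm_on A x : R := Num.sqrt (\sum_(i in A) x ord0 i ^+ 2).

Definition block_norm P x : R := \sum_(A in P) l2norm_on A x.
Definition block_dual_norm P g : R := \big[Num.max/0]_(A in P) l2norm_on A g.

End Norms.

Definition equal_size (T : finType) (P : {set {set T}}) : bool :=
  [forall A in P, forall B in P, #|A| <= #|B| + 1]%N.

(* Partitions are unlabelled: P is the set of its (nonempty) blocks. *)
Definition equal_partitions (d n : nat) : {set {set {set 'I_d}}} :=
  [set P | [&& finset.partition P [set: 'I_d], #|P| == n & equal_size P]]%SET.

Definition Epart {R : realType} {d : nat} (n : nat)
    (F : {set {set 'I_d}} -> R) : R :=
  (\sum_(P in equal_partitions d n) F P) / #|equal_partitions d n|%:R.

Definition gamma_ (R : realType) (n : nat) : R :=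
  if (n <= 1)%N then 1 else if n == 2%N then 2^-1
  else (expR 1 * ln n%:R)^-1.

Definition p_ (R : realType) (n : nat) : R :=
  if (n <= 2)%N then 2 else 1 + (ln n%:R)^-1.

Section Bregman.
Context {R : realType} {d : nat}.
Implicit Types (x y : 'rV[R]_d) (h : 'rV[R]_d -> R) (P : {set {set 'I_d}}).

Definition block_h P x : R :=
  (gamma_ R #|P| * p_ R #|P|)^-1 *
  \sum_(A in P) l2norm_on A x `^ p_ R #|P|.

Definition block_h_scaled P (rho : R) x : R :=
  rho ^+ 2 * block_h P (rho^-1 *: x).

(* The vector of partial derivatives; [block_h] is differentiable everywhere
   because its exponent exceeds 1. *)
Definition gradient h y : 'rV[R]_d :=
  \row_i ('D_(delta_mx ord0 i : 'rV[R]_d) h y).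

Definition bregman h x y : R := h x - h y - dotprod (gradient h y) (x - y).

End Bregman.

Section Gain.
Context {R : realType} {d : nat}.
Implicit Types (K : set 'rV[R]_d) (n s : nat).

Definition block_radius n K : R :=
  \big[Num.max/0]_(P in equal_partitions d n) sup [set block_norm P x | x in K].

(* x1 is the starting point. *)
Definition D_ n K (x1 : 'rV[R]_d) : R :=
  Num.sqrt (Epart n (fun P =>
    sup [set bregman (block_h_scaled P (block_radius n K)) z x1 | z in K])).

Definition sparse_unit s : set 'rV[R]_d :=
  [set c | (forall i, `|c ord0 i| <= 1) /\
           (#|[set i : 'I_d | c ord0 i != 0%R]%SET| <= s)%N].

Definition G_ n s : R :=
  sup [set Num.sqrt (Epart n (fun P => block_dual_norm P c ^+ 2))
      | c in sparse_unit s].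

Definition regret_bound n K (x1 : 'rV[R]_d) s (T : nat) : R :=
  2 * D_ n K x1 * G_ n s * Num.sqrt T%:R.

(* For 1 <= d the default value of the big minimum is its term at n = 1. *)
Definition gain K (x1 : 'rV[R]_d) s : R :=
  Num.min (D_ 1 K x1 * G_ 1 s) (D_ d K x1 * G_ d s) /
  \big[Num.min/D_ 1 K x1 * G_ 1 s]_(1 <= n < d.+1) (D_ n K x1 * G_ n s).

End Gain.

Section Bodies.
Context {R : realType} {d : nat}.
Implicit Types (w x : 'rV[R]_d) (A B : set 'rV[R]_d).

Definition minkowski_sum A B : set 'rV[R]_d := [set x + y | x in A & y in B].
Definition dilate (a : R) A : set 'rV[R]_d := [set a *: x | x in A].

Definition B1 : set 'rV[R]_d := [set x | l1norm x <= 1].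
Definition B2 : set 'rV[R]_d := [set x | l2norm x <= 1].
Definition Binf : set 'rV[R]_d := [set x | linfnorm x <= 1].

(* e_1 is the vector whose coordinate of index 0 is 1. *)
Definition e1 : 'rV[R]_d := \row_i ((i : nat) == 0%N)%:R.
Definition segment_e1 : set 'rV[R]_d :=
  [set ((1 - t) *: (- e1) + t *: e1) | t in [set t : R | 0 <= t <= 1]].

Definition simplex : set 'rV[R]_d :=
  [set x | (forall i, 0 <= x ord0 i) /\ \sum_i x ord0 i = 1].
Definition simplex_center : 'rV[R]_d := const_mx d%:R^-1.
Definition lp_ball (p : R) : set 'rV[R]_d :=
  [set x | \sum_i `|x ord0 i| `^ p <= 1].
Definition ellipsoid w : set 'rV[R]_d :=
  [set x | \sum_i x ord0 i ^+ 2 / w ord0 i ^+ 2 <= 1].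
Definition box w : set 'rV[R]_d :=
  [set x | forall i, `|x ord0 i| <= w ord0 i].

Definition positive_sorted w : Prop :=
  (forall i, 0 < w ord0 i) /\
  (forall i j : 'I_d, (i <= j)%N -> w ord0 j <= w ord0 i).

(* For sorted w, the s largest entries are the first s ones. *)
Definition head_part (s : nat) w : 'rV[R]_d :=
  \row_i (if (i < s)%N then w ord0 i else 0).
Definition tail_part (s : nat) w : 'rV[R]_d :=
  \row_i (if (i < s)%N then 0 else w ord0 i).

End Bodies.

(* x ≍ y with the explicit comparison constants a and b. *)
Definition comparable_with {R : realType} (a b x y : R) : Prop :=
  a * y <= x <= b * y.

(* "f = Ω̃(g)" is: for some c > 0 and k, [tilde_ge c k L f g] holds throughout
   the family, L being the logarithm of the dimension scale in which g is
   expressed, so that only factors of lower order than g are hidden: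
   powers of ln d when the scale is d, powers of ln ln d when it is ln d. *)
Definition tilde_ge {R : realType} (c : R) (k : nat) (L f g : R) : Prop :=
  c * g / L ^+ k <= f.

Definition tilde_le {R : realType} (C : R) (k : nat) (L f g : R) : Prop :=
  f <= C * L ^+ k * g.

(* The logarithms are truncated below at 1, for the sake of small d. *)
Definition log_d (R : realType) (d : nat) : R := Num.max 1 (ln d%:R).
Definition loglog_d (R : realType) (d : nat) : R :=
  Num.max 1 (ln (ln d%:R)).

Definition floor_sqrt (R : realType) (d : nat) : nat :=
  Num.truncn (Num.sqrt d%:R : R).
Definition floor_ln (R : realType) (d : nat) : nat :=
  Num.truncn (ln d%:R : R).

(* Main.v *)
Require Import Defs.
From mathcomp Require Import fingroup perm zify ring lra.
Set Implicit Arguments.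
Unset Strict Implicit.
Unset Printing Implicit Defensive.
Local Open Scope classical_set_scope.
Local Open Scope ring_scope.

(** Write [h = h_(B, rho)] for the scaled potential of a partition, [D n] and
[G n] for [D_ n K x1] and [G_ n s], and [L] for the truncated logarithm [log_d].
Every gain comes from the same comparison: the numbers of blocks [1] and [d]
against as many blocks as the sparsity, [n = s].

Upper bound on [D n] ([D_le]). If [z] and [x1] have block norm at most [rho], the
divergence of [z] from [x1] is at most [2 * rho ^ 2 / gamma_n]: the potential is
homogeneous of degree [p_n], so Euler's identity and Cauchy-Schwarz bound each of
its terms. Hence [D n] is at most [rho_n(K) * sqrt (6 * L n)].

Lower bound on [D n] ([D_sym_ge]). If [K] is symmetric and [y] lies in [K], the
average of the divergences of [y] and [- y] has no first-order term and is at
least [h y]; the power mean inequality and the choice of [gamma_n] and [p_n] make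
[h y] at least half the squared block norm of [y]. So [2 * D n] is at least the
block norm of [y], which is the [l2] norm for one block and the [l1] norm for [d]
blocks. On the simplex the average is taken over the vertices instead, whose mean
is the starting point; this keeps the factor [sqrt (ln d)] of the entropic
geometry ([simplex_sup_ge]).

Bounds on [G n]. Clearly [G 1] is at least [sqrt s] and every [G n] is at least
[1]. For [n = s], [G s] is the root of the expected maximal load when [s] balls
fall into [s] nearly equal bins. By symmetry each [k]-set of coordinates lies in
a block of a random partition with the same probability, so the expected number
of [k]-sets of balls sharing a bin is at most [s * 2 ^ k / k!]; for [k] of order
[ln s] this is at most [1], and [G s ^ 2] is at most [7 * L s] ([G_matched_le]).

Together, if [K] contains points of [l2] norm [r2] and [l1] norm [r1] and its
block norms over [s]-partitions are at most [rho], the gain is at least a constant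
times [min (r2 * sqrt s) r1 / (rho * L d)] ([matched_gain_ge]). It remains to
exhibit such points and radii: power means for the [lp] ball, Cauchy-Schwarz with
the largest weight of each block for the ellipsoid, the split into head and tail
for the box, and the triangle inequality for the Minkowski sums. The special
families are obtained by substituting [q = d ^ (1/4)], and the last claim is the
box with one side [1 / q] and the others [1 / d]. *)

(** * Equal-size partitions *)

Section EqualPartitions.
Local Open Scope nat_scope.
Variables (d n : nat).
Implicit Types (P : {set {set 'I_d}}) (A S T : {set 'I_d}).

Lemma equal_partitionsP P : P \in equal_partitions d n ->
  [/\ finset.partition P [set: 'I_d]%SET, #|P| = n & equal_size P].
Proof. by rewrite inE => /and3P[? /eqP]. Qed.

Lemma sum_blocks (V : nmodType) P (F : 'I_d -> V) :
  P \in equal_partitions d n ->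
  (\sum_(A in P) \sum_(i in A) F i = \sum_i F i)%R.
Proof.
move=> /equal_partitionsP[/and3P[/eqP covP trivP _] _ _].
by rewrite -finset.big_trivIset// covP; apply: eq_bigl => i; rewrite inE.
Qed.

Lemma sum_card_blocks P : P \in equal_partitions d n ->
  \sum_(A in P) #|A| = d.
Proof.
move=> PE; rewrite -[RHS](card_ord d) -sum1_card -(sum_blocks _ PE).
by apply: eq_bigr => A _; rewrite sum1_card.
Qed.

Lemma block_neq0 P A : P \in equal_partitions d n -> A \in P -> 0 < #|A|.
Proof.
move=> /equal_partitionsP[/and3P[_ _ P0] _ _] AP.
by rewrite card_gt0; apply: contraNneq P0 => <-.
Qed.

Lemma block_of P (i : 'I_d) : P \in equal_partitions d n ->
  exists2 A, A \in P & i \in A.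
Proof.
move=> /equal_partitionsP[/and3P[/eqP covP _ _] _ _].
have : i \in finset.cover P by rewrite covP inE.
by case/finset.bigcupP => A AP iA; exists A.
Qed.

(** The smallest block has at most [d / n] elements, and any block exceeds it by at
most one. *)
Lemma card_block_le P A : P \in equal_partitions d n -> A \in P ->
  n * #|A| <= d + n.
Proof.
move=> PE AP; have [_ cP /forallP eqP] := equal_partitionsP PE.
suff : n * #|A|.-1 <= d.
  by have := block_neq0 PE AP; case: #|A| => //= m _; rewrite mulnS addnC leq_add2r.
rewrite -{1}cP -sum_nat_const -[leqRHS](sum_card_blocks PE).
apply: leq_sum => B BP.
have /implyP/(_ AP)/forallP/(_ B)/implyP/(_ BP) := eqP A.
by lia.
Qed.

Lemma mod_class_card m r : r < n ->
  \sum_(i < m) (i %% n == r) = m %/ n + (r < m %% n).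
Proof.
move=> rn; have n0 : 0 < n by exact: leq_ltn_trans rn.
elim: m => [|m IH]; first by rewrite big_ord0 div0n mod0n.
rewrite big_ord_recr/= {}IH.
have := divn_eq m n; set q := m %/ n; set t := m %% n => mE.
have tn : t < n by rewrite ltn_pmod.
have [tn1|tn1] : t.+1 = n \/ t.+1 < n by lia.
  have -> : m.+1 = q.+1 * n by rewrite mE mulSn; lia.
  by rewrite mulnK// modnMl; case: eqP; lia.
have -> : m.+1 = q * n + t.+1 by rewrite mE; lia.
by rewrite divnMDl// modnMDl (divn_small tn1) (modn_small tn1); case: eqP; lia.
Qed.

(** The witness is the partition into residue classes modulo [n], whose sizes
[mod_class_card] computes. *)
Lemma equal_partitions_neq0 : 0 < n <= d -> 0 < #|equal_partitions d n|.
Proof.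
case/andP=> n0 nd; rewrite card_gt0; apply/set0Pn.
pose C (r : 'I_n) := [set i : 'I_d | i %% n == r]%SET.
have CE r : #|C r| = d %/ n + (r < d %% n).
  rewrite -mod_class_card// -sum1_card big_mkcond/=.
  by apply: eq_bigr => i _; rewrite inE; case: eqP.
pose i0 (r : 'I_n) : 'I_d := widen_ord nd r.
have i0C r : i0 r \in C r by rewrite inE/= modn_small.
have Cinj : injective C.
  move=> r r' E; have := i0C r; rewrite E inE/= modn_small// => /eqP ?.
  exact: val_inj.
exists (C @: [set: 'I_n])%SET; rewrite inE; apply/and3P; split.
- apply/and3P; split.
  + apply/eqP/setP => i; rewrite inE; apply/finset.bigcupP.
    exists (C (Ordinal (ltn_pmod i n0))); last by rewrite !inE/=.
    by apply: imset_f; rewrite inE.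
  + apply/finset.trivIsetP => _ _ /imsetP[r _ ->] /imsetP[r' _ ->] rr'.
    rewrite -setI_eq0; apply/eqP/setP => i; rewrite !inE.
    apply/negbTE/negP => /andP[/eqP ir /eqP ir'].
    by case/eqP: rr'; congr C; apply: val_inj; rewrite /= -ir -ir'.
  + apply/imsetP => -[r _ E]; have := i0C r.
    by rewrite -E inE.
- by rewrite card_imset// finset.cardsT card_ord.
- apply/forallP => A; apply/implyP => /imsetP[r _ ->].
  apply/forallP => B; apply/implyP => /imsetP[r' _ ->].
  by rewrite !CE; lia.
Qed.

Definition perm_blocks (s : {perm 'I_d}) P : {set {set 'I_d}} :=
  [set (s @: (A : {set 'I_d}))%SET | A in P]%SET.

Lemma perm_blocks_inj (s : {perm 'I_d}) : injective (perm_blocks s).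
Proof. by apply: imset_inj; apply: imset_inj; exact: perm_inj. Qed.

Lemma perm_blocks_equal s P :
  P \in equal_partitions d n -> perm_blocks s P \in equal_partitions d n.
Proof.
move=> PE; have [partP cP /forallP eqP] := equal_partitionsP PE.
rewrite inE; apply/and3P; split.
- have -> : [set: 'I_d]%SET = (s @: [set: 'I_d])%SET.
    apply/setP => i; rewrite !inE; apply/esym/imsetP.
    by exists (s^-1%g i); rewrite ?inE// permKV.
  by rewrite imset_partition//; exact: perm_inj.
- by rewrite card_imset// ?cP//; apply: imset_inj; exact: perm_inj.
- apply/forallP => A'; apply/implyP => /imsetP[A AP ->].
  apply/forallP => B'; apply/implyP => /imsetP[B BP ->].
  rewrite !card_imset; [|exact: perm_inj..].
  by have /implyP/(_ AP)/forallP/(_ B)/implyP/(_ BP) := eqP A.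
Qed.

(** The number of partitions in which [T] lies inside one block, when [T] is not
empty. *)
Definition covering_count T :=
  \sum_(P in equal_partitions d n) \sum_(A in P) (T \subset A).

Lemma covering_count_perm (s : {perm 'I_d}) T :
  covering_count (s @: T)%SET = covering_count T.
Proof.
rewrite /covering_count (reindex_inj (perm_blocks_inj (s := s))).
have EPs P : (perm_blocks s P \in equal_partitions d n) =
             (P \in equal_partitions d n).
  pose f P := perm_blocks s P.
  have fE : (f @: equal_partitions d n)%SET = equal_partitions d n.
    apply/eqP; rewrite eqEcard card_imset ?leqnn ?andbT; last exact: perm_blocks_inj.
    by apply/fintype.subsetP => _ /imsetP[Q QE ->]; exact: perm_blocks_equal.
  by rewrite -{1}fE mem_imset//; exact: perm_blocks_inj.
apply: eq_big => // P _; rewrite /perm_blocks big_imset/=; last first.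
  by move=> A B _ _; apply: imset_inj; exact: perm_inj.
apply: eq_bigr => A _; congr nat_of_bool; apply/fintype.subsetP/fintype.subsetP => sub i iT.
  by rewrite -(mem_imset A i (@perm_inj _ s)); apply: sub; apply: imset_f.
by case/imsetP: iT => j jT ->; apply: imset_f; exact: sub.
Qed.

(** Match the enumerations of [S] and then of its complement with those of [T] and
its complement. *)
Lemma same_card_perm S T : #|S| = #|T| -> exists s : {perm 'I_d}, (s @: S)%SET = T.
Proof.
move=> cST.
pose l (A : {set 'I_d}) := enum A ++ enum (~: A)%SET.
have lP A : perm_eq (l A) (enum 'I_d).
  apply: uniq_perm; rewrite ?enum_uniq//.
    rewrite cat_uniq !enum_uniq/= andbT; apply/hasPn => i.
    by rewrite !mem_enum inE.
  by move=> i; rewrite mem_cat !mem_enum !inE orbN.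
have lu A : uniq (l A) by rewrite (perm_uniq (lP A)) enum_uniq.
have lin A i : i \in l A by rewrite (perm_mem (lP A)) mem_enum.
have ls A : size (l A) = d by rewrite (perm_size (lP A)) size_enum_ord.
pose f i := nth i (l T) (index i (l S)).
have fi i : index i (l S) < size (l T) by rewrite ls -[ltnRHS](ls S) index_mem.
have f_inj : injective f.
  move=> i j; rewrite /f (set_nth_default i j)// => /eqP.
  rewrite nth_uniq// => /eqP E.
  by rewrite -(nth_index i (lin S i)) E nth_index.
exists (perm f_inj); apply/eqP.
rewrite eqEcard card_imset ?cST ?leqnn ?andbT; last exact: perm_inj.
apply/fintype.subsetP => _ /imsetP[i iS ->]; rewrite permE /f /l index_cat mem_enum iS.
have iT : index i (enum S) < size (enum T) by rewrite -cardE -cST cardE index_mem mem_enum.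
by rewrite nth_cat iT -mem_enum mem_nth.
Qed.

Lemma sum_binomial_covering k S :
  \sum_(P in equal_partitions d n) \sum_(A in P) 'C(#|A :&: S|, k) =
  \sum_(T : {set 'I_d} | (T \subset S) && (#|T| == k)) covering_count T.
Proof.
rewrite /covering_count exchange_big/=; apply: eq_bigr => P _.
rewrite exchange_big/=; apply: eq_bigr => A _.
rewrite -cards_draws -sum1_card big_mkcond/= [RHS]big_mkcond/=.
apply: eq_bigr => T _; rewrite inE finset.subsetI.
by case: (T \subset A); case: (T \subset S); case: (#|T| == k).
Qed.

(** Double counting: by symmetry every [k]-set of coordinates is covered equally
often, so the number of [k]-subsets of [S] inside blocks is
proportional to the number of all [k]-subsets of [S]. *)
Lemma sum_binomial_exchange k S :
  (\sum_(P in equal_partitions d n) \sum_(A in P) 'C(#|A :&: S|, k)) * 'C(d, k) =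
  (\sum_(P in equal_partitions d n) \sum_(A in P) 'C(#|A|, k)) * 'C(#|S|, k).
Proof.
have [T0 cT0|noT] := pickP (fun T : {set 'I_d} => #|T| == k); last first.
  have ST A : 'C(#|A|, k) = 0 :> nat.
    rewrite -cards_draws; apply/eqP; rewrite cards_eq0; apply/eqP/setP => T.
    by rewrite !inE noT andbF.
  by rewrite ST muln0 -[d in 'C(d, k)]card_ord -finset.cardsT ST muln0.
have key S' : \sum_(P in equal_partitions d n) \sum_(A in P) 'C(#|A :&: S'|, k) =
    'C(#|S'|, k) * covering_count T0.
  rewrite sum_binomial_covering -cards_draws -sum_nat_const.
  apply: eq_big => [T|T /andP[_ /eqP cT]]; first by rewrite inE.
  have [s <-] : exists s : {perm 'I_d}, (s @: T)%SET = T0.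
    by apply: same_card_perm; rewrite cT (eqP cT0).
  by rewrite covering_count_perm.
have := key [set: 'I_d]%SET; rewrite finset.cardsT card_ord.
under eq_bigr do under eq_bigr do rewrite finset.setIT.
by move=> ->; rewrite key; lia.
Qed.

End EqualPartitions.

(** * The maximal load of a random partition *)

Section Load.
Local Open Scope nat_scope.

Lemma ffact_le_expn m k : m ^_ k <= m ^ k.
Proof.
elim: k => [|k IH]; first by rewrite ffactn0.
by rewrite ffactnSr expnSr leq_mul// leq_subr.
Qed.

Lemma ffact_ratio b d k : b <= d -> b ^_ k * d ^ k <= b ^ k * d ^_ k.
Proof.
move=> bd; elim: k => [|k IH]; first by rewrite !ffactn0 !expn0.
 rewrite !ffactnSr !expnSr.
have bk : (b - k) * d <= b * (d - k).
  by rewrite mulnBl mulnBr leq_sub2l// mulnC leq_mul2l bd orbT.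
have := leq_mul IH bk; lia.
Qed.

Lemma bin_ratio b d k : b <= d -> 'C(b, k) * d ^ k <= b ^ k * 'C(d, k).
Proof.
move=> bd; rewrite -(leq_pmul2r (fact_gt0 k)) -[leqRHS]mulnA bin_ffact.
by rewrite mulnAC bin_ffact ffact_ratio.
Qed.

(** Each of the [s] blocks, of size [b] at most [2 * d / s], carries at most a
fraction [1 / s] of the expected count. *)
Lemma bin_block_le s b d k : 0 < d -> b <= d -> s * b <= 2 * d ->
  s * 2 ^ k <= k`! -> s * ('C(b, k) * 'C(s, k)) <= 'C(d, k).
Proof.
move=> d0 bd sb sk.
rewrite -(leq_pmul2r (fact_gt0 k)) -(leq_pmul2r (_ : 0 < d ^ k)) ?expn_gt0 ?d0//.
have E1 : 'C(s, k) * k`! <= s ^ k by rewrite bin_ffact ffact_le_expn.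
have E2 := bin_ratio k bd.
have E3 : (s * b) ^ k <= (2 * d) ^ k by case: (k) => [|j]; rewrite ?expn0 ?leq_exp2r.
rewrite !expnMn in E3.
apply: (@leq_trans (s * (s ^ k * (b ^ k * 'C(d, k))))).
  by have := leq_mul (leqnn s) (leq_mul E1 E2); lia.
apply: (@leq_trans (s * (2 ^ k * d ^ k * 'C(d, k)))).
  by rewrite leq_mul2l; apply/orP; right; rewrite mulnA leq_mul2r E3 orbT.
by have := leq_mul (leqnn ('C(d, k) * d ^ k)) sk; lia.
Qed.

(** With as many blocks as marked coordinates, the expected number of marked
[k]-sets inside blocks is at most [s * 2 ^ k / k`!], hence at most [1] once [k]
is of order [ln s]. *)
Lemma sum_binomial_load d s k (S : {set 'I_d}) :
  0 < s <= d -> #|S| <= s -> s * 2 ^ k <= k`! ->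
  \sum_(P in equal_partitions d s) \sum_(A in P) 'C(#|A :&: S|, k) <=
  #|equal_partitions d s|.
Proof.
case/andP=> s0 sd Ss sk.
have [dk|kd] := ltnP d k.
  rewrite big1// => P _; rewrite big1// => A _; apply: bin_small.
  by apply: leq_ltn_trans dk; rewrite -[leqRHS]card_ord max_card.
have Cd : 0 < 'C(d, k) by rewrite bin_gt0.
rewrite -(leq_pmul2r Cd) sum_binomial_exchange big_distrl/= -sum_nat_const.
apply: leq_sum => P PE; rewrite big_distrl/= -(leq_pmul2l s0).
have [_ cP _] := equal_partitionsP PE.
rewrite -[X in X * 'C(d, k)]cP -sum_nat_const big_distrr/=.
apply: leq_sum => A AP.
have Ad : #|A| <= d by rewrite -[leqRHS]card_ord max_card.
have sA : s * #|A| <= 2 * d by have := card_block_le PE AP; lia.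
apply: leq_trans (bin_block_le (leq_trans s0 sd) Ad sA sk).
by rewrite leq_mul2l leq_mul2l leq_bin2l ?orbT.
Qed.

(** This turns a maximum over the blocks into a sum: a block with more than [k - 1]
marked coordinates pays for the excess by its number of marked [k]-sets. *)
Lemma leq_bin_excess k m : 0 < k -> m <= k.-1 + 'C(m, k).
Proof.
move=> k0; have [mk|] := ltnP m k; first by lia.
elim: m => [|m IH]; first by lia.
rewrite leq_eqVlt => /orP[/eqP <-|]; first by rewrite binn; lia.
rewrite ltnS => km; have := IH km; case: k k0 km {IH} => // k _ km.
rewrite binS/=; have Cm : 0 < 'C(m, k) by rewrite bin_gt0 ltnW.
by lia.
Qed.

(** The constant makes [s * 2 ^ k <= k`!] hold at [k = load_threshold s]: from
[k = 5] on, [k`! / 2 ^ k] at least triples at each step. *)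
Definition load_threshold s := trunc_log 3 s + 6.

Lemma load_threshold_fact s : 0 < s -> s * 2 ^ load_threshold s <= (load_threshold s)`!.
Proof.
move=> s0; have sl : s <= 3 ^ (trunc_log 3 s).+1 by rewrite ltnW// trunc_log_ltn.
apply: leq_trans (leq_mul sl (leqnn _)) _.
rewrite /load_threshold; set m := (trunc_log 3 s).+1; have -> : trunc_log 3 s + 6 = 5 + m by rewrite /m; lia.
elim: m => // m IH.
rewrite addnS factS (expnS 3) (expnS 2 (5 + m)) mulnACA.
apply: leq_mul; last exact: IH.
by lia.
Qed.

End Load.

(** * Block norms *)

Section InitialSegment.
Variable d : nat.

Lemma card_initial s : (s <= d)%N -> #|[set i : 'I_d | (i < s)%N]%SET| = s.
Proof.
move=> sd; rewrite -sum1_card; under eq_bigl do rewrite inE.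
by rewrite -(big_ord_widen _ (fun=> 1%N) sd) sum1_card card_ord.
Qed.

Lemma sum_indicator_initial (R : realType) s : (s <= d)%N ->
  \sum_(i < d) (i < s)%N%:R = s%:R :> R.
Proof.
move=> sd; rewrite -[in RHS](card_initial sd) -sum1_card natr_sum [RHS]big_mkcond/=.
by apply: eq_bigr => i _; rewrite inE; case: (i < s)%N.
Qed.

End InitialSegment.

Section FiniteSums.
Variables (R : realType) (I : finType) (P : pred I).
Implicit Types a b : I -> R.

(** Cauchy-Schwarz, from the sum of the squares [(Y * a i - X * b i) ^ 2] where [X]
and [Y] are the two norms. *)
Lemma sum_mul_le_sqrt a b :
  \sum_(i | P i) a i * b i <=
  Num.sqrt (\sum_(i | P i) a i ^+ 2) * Num.sqrt (\sum_(i | P i) b i ^+ 2).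
Proof.
set X := Num.sqrt _; set Y := Num.sqrt (\sum_(i | P i) b i ^+ 2).
have X0 : 0 <= X by exact: sqrtr_ge0.
have Y0 : 0 <= Y by exact: sqrtr_ge0.
have XE : X ^+ 2 = \sum_(i | P i) a i ^+ 2.
  by rewrite sqr_sqrtr// sumr_ge0// => i _; exact: sqr_ge0.
have YE : Y ^+ 2 = \sum_(i | P i) b i ^+ 2.
  by rewrite sqr_sqrtr// sumr_ge0// => i _; exact: sqr_ge0.
have sq0 c Z : Z ^+ 2 = \sum_(i | P i) c i ^+ 2 -> Z = 0 ->
    forall i, P i -> c i = 0 :> R.
  move=> ZE Z0; move: ZE; rewrite Z0 expr0n/= => /esym c0 i Pi.
  by have /eqP := psumr_eq0P (fun i _ => sqr_ge0 (c i)) c0 Pi; rewrite sqrf_eq0 => /eqP.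
have [X_0|X1] := eqVneq X 0.
  by rewrite big1 ?X_0 ?mul0r// => i Pi; rewrite (sq0 _ _ XE X_0)// mul0r.
have [Y_0|Y1] := eqVneq Y 0.
  by rewrite big1 ?Y_0 ?mulr0// => i Pi; rewrite (sq0 _ _ YE Y_0)// mulr0.
have XY : 0 < X * Y by rewrite mulr_gt0// lt_neqAle eq_sym ?X1 ?Y1.
rewrite -(ler_pM2l XY) -(ler_pM2l (ltr0n R 2)).
have -> : 2 * (X * Y * (X * Y)) = Y ^+ 2 * X ^+ 2 + X ^+ 2 * Y ^+ 2 by ring.
rewrite {1}XE {2}YE !mulr_sumr -big_split/=; apply: ler_sum => i _.
have := sqr_ge0 (Y * a i - X * b i); nra.
Qed.

Lemma sqrt_sum_sqr_triangle a b :
  Num.sqrt (\sum_(i | P i) (a i + b i) ^+ 2) <=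
  Num.sqrt (\sum_(i | P i) a i ^+ 2) + Num.sqrt (\sum_(i | P i) b i ^+ 2).
Proof.
have s0 c : 0 <= \sum_(i | P i) c i ^+ 2 :> R.
  by rewrite sumr_ge0// => i _; exact: sqr_ge0.
rewrite -[leRHS]ger0_norm ?addr_ge0 ?sqrtr_ge0// -sqrtr_sqr ler_wsqrtr//.
rewrite sqrrD !sqr_sqrtr//.
have := sum_mul_le_sqrt a b.
set U := Num.sqrt _ * _ => UE.
have -> : \sum_(i | P i) (a i + b i) ^+ 2 = \sum_(i | P i) a i ^+ 2 +
    (\sum_(i | P i) a i * b i) *+ 2 + \sum_(i | P i) b i ^+ 2.
  by under eq_bigr do rewrite sqrrD; rewrite 2!big_split/= sumrMnl.
by rewrite lerD2r lerD2l lerMn2r.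
Qed.

Lemma sqrt_sum_sqr_le a b : (forall i, `|a i| <= `|b i|) ->
  Num.sqrt (\sum_(i | P i) a i ^+ 2) <= Num.sqrt (\sum_(i | P i) b i ^+ 2).
Proof.
move=> ab; apply: ler_wsqrtr; apply: ler_sum => i _.
by rewrite -(real_normK (num_real (a _))) -(real_normK (num_real (b _))) lerXn2r ?nnegrE.
Qed.

Lemma sqrt_sum_sqr_le_sum a : (forall i, P i -> 0 <= a i) ->
  Num.sqrt (\sum_(i | P i) a i ^+ 2) <= \sum_(i | P i) a i.
Proof.
move=> a0; have A0 : 0 <= \sum_(i | P i) a i by exact: sumr_ge0.
rewrite -[leRHS]ger0_norm// -sqrtr_sqr ler_wsqrtr//.
rewrite expr2 big_distrl/=; apply: ler_sum => i Pi; rewrite expr2.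
by rewrite ler_wpM2l ?a0// (bigD1 i)//= lerDl sumr_ge0// => j /andP[]; auto.
Qed.

End FiniteSums.

Section BlockNorms.
Variables (R : realType) (d : nat).
Implicit Types (x y z : 'rV[R]_d) (A : {set 'I_d}) (P : {set {set 'I_d}}).

Lemma l2norm_on_ge0 A x : 0 <= l2norm_on A x.
Proof. exact: sqrtr_ge0. Qed.

Lemma sqr_l2norm_on A x : l2norm_on A x ^+ 2 = \sum_(i in A) x ord0 i ^+ 2.
Proof. by rewrite sqr_sqrtr// sumr_ge0// => i _; exact: sqr_ge0. Qed.

Lemma l2norm_on_eq0 A x i : l2norm_on A x = 0 -> i \in A -> x ord0 i = 0.
Proof.
move=> N0 iA; have := sqr_l2norm_on A x; rewrite N0 expr0n/= => /esym s0.
by have /eqP := psumr_eq0P (fun i _ => sqr_ge0 (x ord0 i)) s0 iA; rewrite sqrf_eq0 => /eqP.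
Qed.

Lemma l2norm_onD A x y : l2norm_on A (x + y) <= l2norm_on A x + l2norm_on A y.
Proof.
rewrite /l2norm_on; under eq_bigr do rewrite mxE; exact: sqrt_sum_sqr_triangle.
Qed.

Lemma l2norm_onZ A (a : R) x : l2norm_on A (a *: x) = `|a| * l2norm_on A x.
Proof.
rewrite /l2norm_on; under eq_bigr do rewrite mxE exprMn.
by rewrite -mulr_sumr sqrtrM ?sqr_ge0// sqrtr_sqr.
Qed.

Lemma l2norm_onN A x : l2norm_on A (- x) = l2norm_on A x.
Proof. by rewrite -scaleN1r l2norm_onZ normrN1 mul1r. Qed.

Lemma l2norm_on_vertex A (i : 'I_d) :
  l2norm_on A (delta_mx ord0 i : 'rV[R]_d) = (i \in A)%:R.
Proof.
rewrite /l2norm_on; case: (boolP (i \in A)) => iA.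
  rewrite (bigD1 i)//= mxE !eqxx expr1n big1 ?addr0 ?sqrtr1// => j /andP[_ ji].
  by rewrite mxE eqxx (negbTE ji) expr0n.
rewrite big1 ?sqrtr0// => j jA; rewrite mxE eqxx.
by case: eqP jA iA => [->->|_ _ _]; rewrite ?expr0n.
Qed.

Lemma l2norm_on_le_sum A x : l2norm_on A x <= \sum_(i in A) `|x ord0 i|.
Proof.
rewrite /l2norm_on; under eq_bigr do rewrite -real_normK ?num_real//.
by apply: sqrt_sum_sqr_le_sum => i _; exact: normr_ge0.
Qed.

Lemma dot_on_le A x y : `|\sum_(i in A) x ord0 i * y ord0 i| <=
  l2norm_on A x * l2norm_on A y.
Proof.
rewrite ler_norml; apply/andP; split; last exact: sum_mul_le_sqrt.
rewrite lerNl -(l2norm_onN A x) -sumrN.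
apply: le_trans (sum_mul_le_sqrt (mem A) (fun i => (- x) ord0 i) (fun i => y ord0 i)).
by rewrite le_eqVlt; apply/orP/or_introl/eqP/eq_bigr => i _; rewrite mxE mulNr.
Qed.

Lemma block_norm_ge0 P x : 0 <= block_norm P x.
Proof. by apply: sumr_ge0 => A _; exact: l2norm_on_ge0. Qed.

Lemma block_normD P x y : block_norm P (x + y) <= block_norm P x + block_norm P y.
Proof. by rewrite -big_split; apply: ler_sum => A _; exact: l2norm_onD. Qed.

Lemma block_normZ P (a : R) x : block_norm P (a *: x) = `|a| * block_norm P x.
Proof. by rewrite mulr_sumr; apply: eq_bigr => A _; exact: l2norm_onZ. Qed.

Lemma block_norm_le_l1norm n P x :
  P \in equal_partitions d n -> block_norm P x <= l1norm x.
Proof.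
move=> PE; rewrite /l1norm -(sum_blocks _ PE).
by apply: ler_sum => A _; exact: l2norm_on_le_sum.
Qed.

Lemma block_norm_le_l2norm n P x :
  P \in equal_partitions d n -> block_norm P x <= Num.sqrt n%:R * l2norm x.
Proof.
move=> PE; have [_ cP _] := equal_partitionsP PE.
rewrite /l2norm -(sum_blocks _ PE) -cP.
have := @sum_mul_le_sqrt R _ (mem P) (fun=> 1) (fun A => l2norm_on A x).
under eq_bigr do rewrite mul1r.
under [X in Num.sqrt X * _]eq_bigr do rewrite expr1n.
rewrite sumr_const.
by under [X in _ * Num.sqrt X]eq_bigr do rewrite sqr_l2norm_on.
Qed.

Lemma block_norm_single P x : P \in equal_partitions d 1 ->
  block_norm P x = l2norm x.
Proof.
move=> PE; have [_ /eqP/cards1P[A PA] _] := equal_partitionsP PE.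
by rewrite /l2norm -(sum_blocks _ PE) /block_norm PA !big_set1.
Qed.

Lemma card_block_singletons P A : P \in equal_partitions d d -> A \in P -> #|A| = 1%N.
Proof.
move=> PE AP; have [_ cP _] := equal_partitionsP PE.
have E : (\sum_(B in P) (#|B| - 1))%N = 0%N.
  rewrite sumnB; last by move=> B BP; exact: block_neq0 PE BP.
  by rewrite (sum_card_blocks PE) sum1_card cP subnn.
have A0 := block_neq0 PE AP.
have : (#|A| - 1 <= \sum_(B in P) (#|B| - 1))%N by rewrite (bigD1 A)//= leq_addr.
by rewrite E; lia.
Qed.

Lemma block_norm_singletons P x : P \in equal_partitions d d ->
  block_norm P x = l1norm x.
Proof.
move=> PE; rewrite /l1norm -(sum_blocks _ PE); apply: eq_bigr => A AP.
have /eqP/cards1P[i ->] := card_block_singletons PE AP.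
by rewrite /l2norm_on !big_set1 sqrtr_sqr.
Qed.

End BlockNorms.

(** * The gradient of a power of a block norm *)

Section Gradient.
Variables (R : realType) (d : nat).
Implicit Types (x y z : 'rV[R]_d) (A : {set 'I_d}) (P : {set {set 'I_d}}) (p : R).

(** This is where [p > 1] is needed: it makes the potential differentiable also where
a block of the vector vanishes. *)
Lemma is_derive_abs_powR p : 1 < p -> is_derive (0 : R) 1 (fun t : R => `|t| `^ p) 0.
Proof.
move=> p1; have p10 : 0 < p - 1 by rewrite subr_gt0.
have p0 : p != 0 by rewrite gt_eqF// (lt_trans ltr01).
have H : (fun h : R => h^-1 *: (((fun t : R => `|t| `^ p) \o shift 0) (h *: 1) -
   `|0 : R| `^ p)) @ (0 : R)^' --> (0 : R).
  apply/cvgrPdist_lt => e e0.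
  have del0 : 0 < e `^ (p - 1)^-1 by exact: powR_gt0.
  near=> h.
  have h0 : h != 0 by near: h; exact: nbhs_dnbhs_neq.
  have hd : `|h| < e `^ (p - 1)^-1 by near: h; exact: (@dnbhs0_lt _ R^o).
  rewrite sub0r normrN /= /shift addr0 normr0 powR0// subr0 normrZ normfV.
  rewrite [h *: 1]mulr1 (ger0_norm (powR_ge0 _ _)).
  rewrite -(@mulr_powRB1 _ `|h| p) ?normr_ge0//; last exact: lt_trans p1.
  rewrite mulKf ?normr_eq0//.
  have := gt0_ltr_powR p10; move=> /(_ _ _ _ _ hd).
  rewrite -powRrM mulVf ?gt_eqF// powRr1 ?ltW//; apply; rewrite nnegrE//.
  exact: powR_ge0.
split; first by apply/cvg_ex; exists 0.
exact: cvg_lim H.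
Unshelve. all: by end_near. Qed.

(** A directional derivative only sees the restriction of [f] to a line, so the
calculus below is that of one real variable. *)
Lemma is_derive_line (f : 'rV[R]_d -> R) y v (df : R) :
  is_derive (0 : R) 1 (fun t : R => f (t *: v + y)) df -> is_derive y v f df.
Proof.
move=> [H1 H2]; split; first exact/derivable1P.
rewrite -H2 /derive; set g1 := fun h => h^-1 *: _; set g2 := fun h => h^-1 *: _.
suff -> : g1 = g2 by [].
apply/funext => h; rewrite /g1 /g2 /=.
by rewrite addr0 scale0r add0r [_%:A]mulr1.
Qed.

Lemma sqr_l2norm_on_line A y i (t : R) :
  l2norm_on A (t *: delta_mx ord0 i + y) ^+ 2 =
  l2norm_on A y ^+ 2 + (i \in A)%:R * (2 * t * y ord0 i + t ^+ 2).
Proof.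
rewrite !sqr_l2norm_on.
under eq_bigr => j _ do rewrite !mxE eqxx/=.
have [iA|iA] := boolP (i \in A); last first.
  rewrite mul0r addr0; apply: eq_bigr => j jA.
  by rewrite (_ : j == i = false) ?mulr0 ?add0r//; apply: contraNF iA => /eqP <-.
rewrite (bigD1 i)//= [in RHS](bigD1 i)//= eqxx.
under eq_bigr => j /andP[_ /negbTE ->] do rewrite mulr0 add0r.
rewrite [t * _]mulr1; ring.
Qed.

(** Along a coordinate direction the squared block norm is a quadratic polynomial in
the parameter, composed with a power that is smooth away from [0]. *)
Lemma is_derive_l2norm_on_powR A p y i : 1 < p ->
  is_derive y (delta_mx ord0 i) (fun x => l2norm_on A x `^ p)
    (p * (l2norm_on A y `^ (p - 2) * ((i \in A)%:R * y ord0 i))).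
Proof.
move=> p1; apply: is_derive_line.
have p0 : 0 < p by exact: lt_trans p1.
have lineE t : l2norm_on A (t *: delta_mx ord0 i + y) `^ p =
    Num.sqrt (l2norm_on A y ^+ 2 + (i \in A)%:R * (2 * t * y ord0 i + t ^+ 2)) `^ p.
  by rewrite -sqr_l2norm_on_line sqrtr_sqr ger0_norm ?l2norm_on_ge0.
rewrite (funext lineE) => {lineE}.
have [iA|iA] := boolP (i \in A); last first.
  rewrite mul0r !mulr0.
  under eq_fun do rewrite mul0r addr0.
  exact: is_derive_cst.
under eq_fun do rewrite mul1r.
rewrite mul1r.
have [N0|N1] := eqVneq (l2norm_on A y) 0.
  rewrite N0 (l2norm_on_eq0 N0 iA) !mulr0.
  under eq_fun do rewrite mulr0 expr0n/= !add0r sqrtr_sqr.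
  exact: is_derive_abs_powR.
have Npos : 0 < l2norm_on A y by rewrite lt_neqAle eq_sym N1 l2norm_on_ge0.
pose q : {poly R} := (l2norm_on A y ^+ 2)%:P + ((2 * y ord0 i) *: 'X + 'X^2).
have qE t : q.[t] = l2norm_on A y ^+ 2 + (2 * t * y ord0 i + t ^+ 2).
  by rewrite !hornerD hornerC hornerZ hornerX hornerXn; ring.
have q_ge0 t : 0 <= q.[t].
  by have := sqr_l2norm_on_line A y i t; rewrite iA mul1r qE => <-; rewrite sqr_ge0.
have q0E : q.[0] = l2norm_on A y ^+ 2 by rewrite qE mulr0 mul0r expr0n/= !addr0.
have q0 : 0 < q.[0] by rewrite q0E exprn_gt0.
have -> : (fun t => Num.sqrt (l2norm_on A y ^+ 2 + (2 * t * y ord0 i + t ^+ 2)) `^ p) =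
    (fun x : R => x `^ (2^-1 * p)) \o horner q.
  by apply/funext => t; rewrite /= -qE powRrM powR12_sqrt.
apply: is_derive_eq.
  exact: (is_derive1_comp (is_derive1_powR (2^-1 * p) q0) (is_derive_poly q 0)).
rewrite q0E -powR_mulrn ?ltW// -powRrM.
have -> : 2%:R * (2^-1 * p - 1) = p - 2 by field.
rewrite derivD derivC add0r derivD derivZ derivX derivXn hornerD hornerZ.
rewrite hornerC hornerMn hornerX mul0rn addr0.
by field.
Qed.

End Gradient.

(** * Power means and the constants of the potential *)

Section PowerMeans.
Variable R : realType.

(** Young's inequality, read as the tangent line inequality at [m]. *)
Lemma powR_tangent (x m p : R) : 0 <= x -> 0 <= m -> 1 < p ->
  p * m `^ (p - 1) * x <= x `^ p + (p - 1) * m `^ p.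
Proof.
move=> x0 m0 p1; have p0 : 0 < p by exact: lt_trans p1.
have p10 : 0 < p - 1 by rewrite subr_gt0.
have q0 : 0 < p / (p - 1) by exact: divr_gt0.
have pq : p^-1 + (p / (p - 1))^-1 = 1.
  by rewrite invf_div -{1}[p^-1]mul1r -mulrDl addrC subrK divff// gt_eqF.
have := conjugate_powR x0 (powR_ge0 m (p - 1)) p0 q0 pq.
rewrite -powRrM (_ : (p - 1) * (p / (p - 1)) = p); last first.
  by rewrite mulrC divfK// gt_eqF.
rewrite invf_div -(ler_pM2l p0).
have -> : p * (x `^ p / p + m `^ p * ((p - 1) / p)) = x `^ p + (p - 1) * m `^ p.
  by field; rewrite gt_eqF.
by have -> : p * (x * m `^ (p - 1)) = p * m `^ (p - 1) * x by ring.
Qed.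

(** Sum the tangent inequalities at the mean. *)
Lemma power_mean (I : finType) (Q : {pred I}) (a : I -> R) (p : R) :
  1 < p -> (forall i, i \in Q -> 0 <= a i) -> (0 < #|Q|)%N ->
  #|Q|%:R `^ (1 - p) * (\sum_(i in Q) a i) `^ p <= \sum_(i in Q) a i `^ p.
Proof.
move=> p1 a0 Q0; have n0 : (0 : R) < #|Q|%:R by rewrite ltr0n.
set n : R := #|Q|%:R in n0 *; set T := \sum_(i in Q) a i.
have T0 : 0 <= T by exact: sumr_ge0.
pose m := T / n; have m0 : 0 <= m by rewrite divr_ge0// ltW.
have p0 : 0 < p by exact: lt_trans p1.
have le : \sum_(i in Q) p * m `^ (p - 1) * a i <=
    \sum_(i in Q) (a i `^ p + (p - 1) * m `^ p).
  by apply: ler_sum => i iQ; apply: powR_tangent => //; exact: a0.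
rewrite -mulr_sumr big_split/= sumr_const -/T -[_ *+ #|Q|]mulr_natl -/n in le.
have TE : T = n * m by rewrite /m mulrCA divff ?mulr1// gt_eqF.
have mm : m `^ (p - 1) * m = m `^ p by rewrite mulrC mulr_powRB1.
have nn : n `^ (1 - p) * n `^ p = n.
  rewrite -powRD; last by apply/implyP => _; rewrite gt_eqF.
  by rewrite subrK powRr1// ltW.
have -> : n `^ (1 - p) * T `^ p = n * m `^ p.
  by rewrite TE powRM ?(ltW n0)// mulrA nn.
move: le; have -> : p * m `^ (p - 1) * T = p * n * m `^ p.
  by rewrite TE -mm; ring.
by move=> le; nra.
Qed.

End PowerMeans.

Section PotentialConstants.
Variable R : realType.

(** From [5 / 6 <= exp (- 1 / 6)], raised to the sixth power. *)
Lemma expR1_le3 : expR 1 <= 3 :> R.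
Proof.
have h : (5 / 6 : R) <= expR (- (6^-1)).
  by apply: le_trans (expR_ge1Dx _); lra.
have e0 := expR_gt0 (6^-1 : R).
have -> : (1 : R) = 6%:R * 6^-1 by rewrite divff// pnatr_eq0.
rewrite expRM_natl.
have h2 : expR 6^-1 <= (6 / 5 : R).
  by rewrite -[leLHS]invrK -expRN -[leRHS]invrK lef_pV2 ?posrE ?expR_gt0//; lra.
by apply: (@le_trans _ _ ((6 / 5) ^+ 6)); [rewrite lerXn2r// nnegrE; lra | lra].
Qed.

Lemma ln3_ge1 : 1 <= ln 3 :> R.
Proof. by rewrite -[leLHS]expRK ler_ln ?posrE ?expR_gt0// expR1_le3. Qed.

Lemma ln_ge1 n : (3 <= n)%N -> 1 <= ln n%:R :> R.
Proof.
move=> n3; apply: le_trans ln3_ge1 _.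
by rewrite ler_ln ?posrE ?ltr0n ?ler_nat//; lia.
Qed.

Lemma log_d_ge1 n : 1 <= log_d R n.
Proof. by rewrite /log_d le_max lexx. Qed.

Lemma sqrt_logs_le n : Num.sqrt (6 * log_d R n) * Num.sqrt (7 * log_d R n) <=
  7 * log_d R n.
Proof.
have L1 := log_d_ge1 n; have L0 : 0 <= 7 * log_d R n by lra.
rewrite -[leRHS]sqr_sqrtr// expr2 ler_wpM2r ?sqrtr_ge0//.
by apply: ler_wsqrtr; lra.
Qed.

Lemma log_d_le n m : (0 < n <= m)%N -> log_d R n <= log_d R m.
Proof.
move=> /andP[n0 nm]; rewrite /log_d ge_max le_max lexx/=.
by rewrite le_max ler_ln ?orbT ?posrE ?ltr0n ?ler_nat ?nm ?orbT//; exact: leq_trans nm.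
Qed.

Lemma gamma_gt0 n : 0 < gamma_ R n.
Proof.
rewrite /gamma_; case: ifPn => [//|n1]; case: ifPn => [_|n2]; first by rewrite invr_gt0.
rewrite invr_gt0 mulr_gt0 ?expR_gt0//.
by apply: lt_le_trans ltr01 (ln_ge1 _); lia.
Qed.

Lemma inv_gamma_le n : (gamma_ R n)^-1 <= 3 * log_d R n.
Proof.
have L1 := log_d_ge1 n.
rewrite /gamma_; case: ifPn => [_|n1]; first by rewrite invr1; lra.
case: ifPn => [_|n2]; first by rewrite invrK; lra.
rewrite invrK ler_pM ?expR_ge0 ?expR1_le3//; last by rewrite /log_d le_max lexx orbT.
by apply: le_trans ler01 (ln_ge1 _); lia.
Qed.

Lemma p_gt1 n : 1 < p_ R n.
Proof.
rewrite /p_; case: ifPn => [_|n2]; first by rewrite ltr1n.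
rewrite ltrDl invr_gt0; apply: lt_le_trans ltr01 (ln_ge1 _); lia.
Qed.

Lemma p_le2 n : p_ R n <= 2.
Proof.
rewrite /p_; case: ifPn => [//|n2].
have n3 : (3 <= n)%N by lia.
rewrite [leRHS](_ : 2 = 1 + 1 :> R)// lerD2l invf_le1 ?ln_ge1//.
exact: lt_le_trans ltr01 (ln_ge1 _).
Qed.

(** [p_ n - 1 = 1 / ln n], and [n] to this power is [e]. *)
Lemma natr_powR_1subp n : (3 <= n)%N -> n%:R `^ (1 - p_ R n) = (expR 1)^-1.
Proof.
move=> n3; have ln0 : 0 < ln n%:R :> R by exact: lt_le_trans ltr01 (ln_ge1 _).
rewrite /p_ ifN; last by rewrite -ltnNge.
rewrite opprD addrA subrr sub0r /powR pnatr_eq0 ifN; last by lia.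
by rewrite mulNr mulVf ?gt_eqF// expRN.
Qed.

(** This is why [gamma_ n] and [p_ n] are matched as they are: the potential of
a vector with [n] equal blocks does not lose against the squared block norm. *)
Lemma potential_constant_ge n : (0 < n)%N ->
  2^-1 <= (gamma_ R n * p_ R n)^-1 * n%:R `^ (1 - p_ R n).
Proof.
move=> n0; have [n3|] := leqP 3 n; last first.
  case: n n0 => [//|[|[|//]]] _ _; rewrite /gamma_ /p_/=.
    by rewrite powR1 mul1r mulr1.
  by rewrite mulVf ?pnatr_eq0// invr1 mul1r -opprB (_ : 2 - 1 = 1 :> R) ?powR_inv1 //; lra.
rewrite natr_powR_1subp//.
have ln0 : 0 < ln n%:R :> R by exact: lt_le_trans ltr01 (ln_ge1 _).
have e0 := expR_gt0 (1 : R).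
have p1 := p_gt1 n; have p2 := p_le2 n; have l1 := ln_ge1 n3.
have -> : gamma_ R n = (expR 1 * ln n%:R)^-1.
  by rewrite /gamma_ !ifN//; lia.
have -> : ((expR 1 * ln n%:R)^-1 * p_ R n)^-1 / expR 1 = ln n%:R / p_ R n.
  by field; rewrite !gt_eqF//; lra.
rewrite ler_pdivlMr; last lra.
lra.
Qed.

End PotentialConstants.

(** * Bregman divergences of the block potential *)

Section BlockBregman.
Variables (R : realType) (d : nat).
Implicit Types (x y z u : 'rV[R]_d) (A : {set 'I_d}) (P : {set {set 'I_d}}) (p rho : R).

Lemma is_derive_bigsum (I : Type) (r : seq I) (Q : pred I)
    (f : I -> 'rV[R]_d -> R) (df : I -> R) y v :
  (forall i, is_derive y v (f i) (df i)) ->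
  is_derive y v (fun x => \sum_(i <- r | Q i) f i x) (\sum_(i <- r | Q i) df i).
Proof.
move=> H; elim: r => [|i r IH].
  under eq_fun do rewrite big_nil.
  by rewrite big_nil; exact: is_derive_cst.
under eq_fun do rewrite big_cons.
rewrite big_cons; case: (Q i) => //.
by apply: is_deriveD; exact: H.
Qed.

Definition power_sum P p x : R := \sum_(A in P) l2norm_on A x `^ p.

(** The derivative of [power_sum P p] at [y] in the direction [u]. *)
Definition power_slope P p y u : R :=
  p * \sum_(A in P) l2norm_on A y `^ (p - 2) * \sum_(i in A) y ord0 i * u ord0 i.

Lemma power_sum_ge0 P p x : 0 <= power_sum P p x.
Proof. by apply: sumr_ge0 => A _; exact: powR_ge0. Qed.

Lemma power_sumN P p x : power_sum P p (- x) = power_sum P p x.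
Proof. by apply: eq_bigr => A _; rewrite l2norm_onN. Qed.

Lemma power_slopeD P p y u z :
  power_slope P p y (u + z) = power_slope P p y u + power_slope P p y z.
Proof.
rewrite /power_slope -mulrDr -big_split/=; congr (_ * _); apply: eq_bigr => A _.
rewrite -mulrDr -big_split/=; congr (_ * _); apply: eq_bigr => i _.
by rewrite mxE mulrDr.
Qed.

Lemma power_slopeN P p y u : power_slope P p y (- u) = - power_slope P p y u.
Proof.
rewrite /power_slope -mulrN -sumrN; congr (_ * _); apply: eq_bigr => A _.
by rewrite -mulrN -sumrN; congr (_ * _); apply: eq_bigr => i _; rewrite mxE mulrN.
Qed.

(** Euler's identity for the [p]-homogeneous [power_sum]. *)
Lemma power_slope_self P p y : 1 < p ->
  power_slope P p y y = p * power_sum P p y.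
Proof.
move=> p1; have p0 : p != 0 by rewrite gt_eqF// (lt_trans ltr01).
congr (_ * _); apply: eq_bigr => A _.
under eq_bigr do rewrite -expr2.
rewrite -sqr_l2norm_on; have [N0|N1] := eqVneq (l2norm_on A y) 0.
  by rewrite N0 expr0n/= mulr0 powR0.
rewrite -powR_mulrn ?l2norm_on_ge0// -powRD ?subrK//.
by apply/implyP.
Qed.

Lemma power_slope_le P p y u rho : 1 < p -> 0 <= rho ->
  block_norm P y <= rho -> block_norm P u <= rho ->
  `|power_slope P p y u| <= p * rho `^ p.
Proof.
move=> p1 rho0 yr ur; have p0 : 0 < p by exact: lt_trans p1.
have p10 : 0 < p - 1 by rewrite subr_gt0.
rewrite /power_slope normrM gtr0_norm// ler_pM2l//.
rewrite -(mulr_powRB1 rho0 p0) mulrC.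
apply: (@le_trans _ _ (rho `^ (p - 1) * block_norm P u)); last first.
  by rewrite ler_wpM2l// powR_ge0.
rewrite /block_norm mulr_sumr; apply: le_trans (ler_norm_sum _ _ _) _.
apply: ler_sum => A AP; rewrite normrM ger0_norm ?powR_ge0//.
have Ny : l2norm_on A y <= rho.
  apply: le_trans yr; rewrite /block_norm (bigD1 A)//= lerDl.
  by apply: sumr_ge0 => B _; exact: l2norm_on_ge0.
apply: le_trans (ler_wpM2l (powR_ge0 _ _) (dot_on_le _ _ _)) _.
rewrite mulrA ler_wpM2r ?l2norm_on_ge0//.
have [N0|N1] := eqVneq (l2norm_on A y) 0.
  by rewrite N0 mulr0 powR_ge0.
have Npos : 0 < l2norm_on A y by rewrite lt_neqAle eq_sym N1 l2norm_on_ge0.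
rewrite mulrC (_ : p - 2 = p - 1 - 1); last by ring.
rewrite mulr_powRB1 ?l2norm_on_ge0//.
by apply: ge0_ler_powR => //; rewrite ?nnegrE ?ltW.
Qed.

Lemma power_sum_le P p x rho : 1 < p -> 0 <= rho ->
  block_norm P x <= rho -> power_sum P p x <= rho `^ p.
Proof.
move=> p1 rho0 xr; have p0 : 0 < p by exact: lt_trans p1.
rewrite -(ler_pM2l p0) -power_slope_self//; apply: le_trans (ler_norm _) _.
exact: power_slope_le.
Qed.

(** The potential is homogeneous, so rescaling it by [rho] only changes the constant
in front of [power_sum]. *)
Definition scaled_weight P rho : R :=
  rho ^+ 2 * (gamma_ R #|P| * p_ R #|P|)^-1 * rho^-1 `^ p_ R #|P|.

Lemma block_h_scaledE P rho : 0 < rho ->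
  block_h_scaled P rho = (fun x => scaled_weight P rho * power_sum P (p_ R #|P|) x).
Proof.
move=> rho0; apply/funext => x.
rewrite /block_h_scaled /block_h /scaled_weight -!mulrA; congr (_ * (_ * _)).
congr (_ * _); rewrite /power_sum mulr_sumr; apply: eq_bigr => A _.
by rewrite l2norm_onZ gtr0_norm ?invr_gt0// powRM ?l2norm_on_ge0// invr_ge0 ltW.
Qed.

Lemma dotprod_gradient P rho y u : 0 < rho ->
  dotprod (gradient (block_h_scaled P rho) y) u =
  scaled_weight P rho * power_slope P (p_ R #|P|) y u.
Proof.
move=> rho0; rewrite block_h_scaledE//; set k := scaled_weight P rho.
set p := p_ R _; have p1 : 1 < p := p_gt1 R _.
have D i : is_derive y (delta_mx ord0 i) (fun x => k * power_sum P p x)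
    (k * \sum_(A in P) p * (l2norm_on A y `^ (p - 2) * ((i \in A)%:R * y ord0 i))).
  apply: is_deriveZ; apply: is_derive_bigsum => A.
  exact: is_derive_l2norm_on_powR.
rewrite /dotprod; under eq_bigr => i _ do rewrite mxE (@derive_val _ _ _ _ _ _ _ (D i)).
under eq_bigr => i _ do rewrite -mulrA.
rewrite -mulr_sumr; congr (_ * _).
under eq_bigr => i _ do rewrite mulr_suml.
rewrite exchange_big/= /power_slope mulr_sumr; apply: eq_bigr => A _.
rewrite !mulr_sumr [RHS]big_mkcond/=; apply: eq_bigr => i _.
by case: (i \in A); rewrite ?mul1r ?mul0r ?mulr0 ?mul0r// !mulrA.
Qed.

(** Euler's identity has absorbed the part of the first-order term along [y]. *)
Lemma bregman_blockE P rho x y : 0 < rho ->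
  bregman (block_h_scaled P rho) x y = scaled_weight P rho *
   (power_sum P (p_ R #|P|) x + (p_ R #|P| - 1) * power_sum P (p_ R #|P|) y
    - power_slope P (p_ R #|P|) y x).
Proof.
move=> rho0; rewrite /bregman dotprod_gradient// power_slopeD power_slopeN.
rewrite power_slope_self ?p_gt1// block_h_scaledE//; ring.
Qed.

Lemma scaled_weight_ge0 P rho : 0 <= scaled_weight P rho.
Proof.
have p0 : 0 < p_ R #|P| by exact: lt_trans ltr01 (p_gt1 _ _).
apply: mulr_ge0; last exact: powR_ge0.
by rewrite mulr_ge0 ?sqr_ge0// invr_ge0 ltW// mulr_gt0 ?gamma_gt0.
Qed.

Lemma scaled_weightM P rho : 0 < rho ->
  scaled_weight P rho * rho `^ p_ R #|P| = rho ^+ 2 * (gamma_ R #|P| * p_ R #|P|)^-1.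
Proof.
move=> rho0; rewrite /scaled_weight -mulrA -powRM ?invr_ge0 ?ltW//.
by rewrite mulVf ?gt_eqF// powR1 mulr1.
Qed.

Lemma bregman_block_le P rho x y : 0 < rho ->
  block_norm P x <= rho -> block_norm P y <= rho ->
  bregman (block_h_scaled P rho) x y <= 2 * rho ^+ 2 / gamma_ R #|P|.
Proof.
move=> rho0 xr yr; rewrite bregman_blockE//; set p := p_ R #|P|.
have p1 : 1 < p := p_gt1 R _; have g0 := gamma_gt0 R #|P|.
have -> : 2 * rho ^+ 2 / gamma_ R #|P| =
    scaled_weight P rho * (2 * p * rho `^ p).
  have -> : scaled_weight P rho * (2 * p * rho `^ p) =
    2 * p * (scaled_weight P rho * rho `^ p) by ring.
  rewrite scaled_weightM// -/p; field; rewrite !gt_eqF//.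
  exact: lt_trans ltr01 p1.
apply: ler_wpM2l; first exact: scaled_weight_ge0.
have h1 := power_sum_le p1 (ltW rho0) xr.
have h2 := power_sum_le p1 (ltW rho0) yr.
have := power_slope_le p1 (ltW rho0) yr xr; rewrite ler_norml => /andP[h3 _].
have h4 : (p - 1) * power_sum P p y <= (p - 1) * rho `^ p.
  by rewrite ler_wpM2l// subr_ge0 ltW.
lra.
Qed.

(** Averaging over the two points [z] and [- z] kills the first-order term of the
divergence and leaves at least the potential of [z]. *)
Lemma bregman_block_sym P rho z y : 0 < rho ->
  2 * (scaled_weight P rho * power_sum P (p_ R #|P|) z) <=
  bregman (block_h_scaled P rho) z y + bregman (block_h_scaled P rho) (- z) y.
Proof.
move=> rho0; rewrite !bregman_blockE// power_sumN power_slopeN.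
set p := p_ R #|P|; have p1 : 1 < p := p_gt1 R _.
have := power_sum_ge0 P p y; have := scaled_weight_ge0 P rho.
set w := scaled_weight P rho => w0 s0.
have : 0 <= w * ((p - 1) * power_sum P p y).
  by apply: mulr_ge0 => //; apply: mulr_ge0 => //; rewrite subr_ge0 ltW.
lra.
Qed.

(** The power mean inequality bounds the potential from below by a [p]-th power of
the block norm; since the latter is at most [rho] and [p <= 2], its square is
smaller still after rescaling. *)
Lemma scaled_power_sum_ge P rho x : 0 < rho -> (0 < #|P|)%N ->
  block_norm P x <= rho ->
  2^-1 * block_norm P x ^+ 2 <= scaled_weight P rho * power_sum P (p_ R #|P|) x.
Proof.
move=> rho0 P0 xr; set T := block_norm P x in xr *; set p := p_ R #|P|.
have p1 : 1 < p := p_gt1 R _; have p2 : p <= 2 := p_le2 R _.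
have p0 : 0 < p by exact: lt_trans p1.
have T0 : 0 <= T by exact: block_norm_ge0.
have [Tz|Tn0] := eqVneq T 0.
  by rewrite Tz expr0n/= mulr0 mulr_ge0// ?scaled_weight_ge0 ?power_sum_ge0.
have Tpos : 0 < T by rewrite lt_neqAle eq_sym Tn0.
have pm : #|P|%:R `^ (1 - p) * T `^ p <= power_sum P p x.
  by apply: power_mean => // A _; exact: l2norm_on_ge0.
apply: le_trans (ler_wpM2l (scaled_weight_ge0 _ _) pm).
have tr : (T / rho) ^+ 2 <= (T / rho) `^ p.
  rewrite -powR_mulrn ?divr_ge0 ?(ltW rho0)//; apply: ger_powR => //.
  by rewrite divr_gt0//= ler_pdivrMr// mul1r.
have rE : scaled_weight P rho * (#|P|%:R `^ (1 - p) * T `^ p) =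
   rho ^+ 2 * ((gamma_ R #|P| * p)^-1 * #|P|%:R `^ (1 - p)) * (T / rho) `^ p.
  by rewrite powRM ?invr_ge0 ?ltW// /scaled_weight -/p; ring.
rewrite rE; have := potential_constant_ge R P0; rewrite -/p.
set c := (_ * _ `^ _) => c2.
have TE : T ^+ 2 = rho ^+ 2 * (T / rho) ^+ 2 by rewrite -exprMn mulrCA divff ?mulr1// gt_eqF.
rewrite TE mulrCA -[leRHS]mulrA ler_pM2l ?exprn_gt0//.
by apply: ler_pM => //; rewrite ?sqr_ge0 ?invr_ge0.
Qed.

End BlockBregman.

(** * Diameters and sparse gradients *)

Section Averages.
Variables (R : realType) (d n : nat).
Implicit Types (F : {set {set 'I_d}} -> R) (c : R).

Lemma Epart_le F c : 0 <= c ->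
  (forall P, P \in equal_partitions d n -> F P <= c) -> Epart n F <= c.
Proof.
move=> c0 Fc; rewrite /Epart.
have [->|N0] := eqVneq #|equal_partitions d n| 0%N; first by rewrite invr0 mulr0.
rewrite ler_pdivrMr; last by rewrite ltr0n lt0n.
by rewrite mulrC mulr_natl -sumr_const; apply: ler_sum.
Qed.

Lemma Epart_ge F c : (0 < n <= d)%N ->
  (forall P, P \in equal_partitions d n -> c <= F P) -> c <= Epart n F.
Proof.
move=> nd Fc; rewrite /Epart ler_pdivlMr; last by rewrite ltr0n equal_partitions_neq0.
by rewrite mulrC mulr_natl -sumr_const; apply: ler_sum.
Qed.

End Averages.

Section Diameter.
Variables (R : realType) (d : nat) (K : set 'rV[R]_d) (x1 : 'rV[R]_d) (M : R).
Hypotheses (Kx1 : K x1) (KM : forall x, K x -> l1norm x <= M).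
Implicit Types (n : nat) (P : {set {set 'I_d}}).

Lemma block_norm_le_radius n P x : P \in equal_partitions d n -> K x ->
  block_norm P x <= block_radius n K.
Proof.
move=> PE Kx; apply: (@le_trans _ _ (sup [set block_norm P y | y in K])).
  apply: ub_le_sup; last by exists x.
  exists M => _ [y Ky <-]; apply: le_trans (KM Ky); exact: block_norm_le_l1norm PE.
exact: (@le_bigmax_cond _ _ _ _ _ _ (fun P => sup [set block_norm P y | y in K])).
Qed.

Lemma block_radius_le n r : 0 <= r ->
  (forall P x, P \in equal_partitions d n -> K x -> block_norm P x <= r) ->
  block_radius n K <= r.
Proof.
move=> r0 H; apply: bigmax_le => // P PE; apply: ge_sup.
  by exists (block_norm P x1), x1.
by move=> _ [y Ky <-]; exact: H.
Qed.

Lemma D_ge0 n : 0 <= D_ n K x1.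
Proof. exact: sqrtr_ge0. Qed.

Lemma bregman_le_sup n P z : 0 < block_radius n K ->
  P \in equal_partitions d n -> K z ->
  bregman (block_h_scaled P (block_radius n K)) z x1 <=
  sup [set bregman (block_h_scaled P (block_radius n K)) z x1 | z in K].
Proof.
move=> r0 PE Kz; apply: ub_le_sup; last by exists z.
exists (2 * block_radius n K ^+ 2 / gamma_ R #|P|) => _ [y Ky <-].
by apply: bregman_block_le => //; apply: block_norm_le_radius.
Qed.

(** Every point of [K] has block norm at most the radius, for every partition, so
the uniform bound on the divergence survives the supremum and the average; the
factor [6 * log_d] is twice the bound on [1 / gamma_]. *)
Lemma D_le n : 0 < block_radius n K ->
  D_ n K x1 <= block_radius n K * Num.sqrt (6 * log_d R n).
Proof.
move=> r0; have L1 := log_d_ge1 R n.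
rewrite -[X in X * _]ger0_norm ?(ltW r0)// -sqrtr_sqr -sqrtrM ?sqr_ge0//.
apply: ler_wsqrtr; apply: Epart_le => [|P PE].
  by rewrite mulr_ge0 ?sqr_ge0//; lra.
apply: ge_sup; first by exists (bregman (block_h_scaled P (block_radius n K)) x1 x1), x1.
move=> _ [z Kz <-]; apply: le_trans (bregman_block_le r0 _ _) _.
- exact: block_norm_le_radius PE Kz.
- exact: block_norm_le_radius PE Kx1.
have [_ -> _] := equal_partitionsP PE.
rewrite [leLHS](_ : _ = block_radius n K ^+ 2 * (2 * (gamma_ R n)^-1)); last by ring.
rewrite ler_wpM2l ?sqr_ge0//; have := inv_gamma_le R n; lra.
Qed.

Lemma D_ge_sqrt n c : (0 < n <= d)%N ->
  (forall P, P \in equal_partitions d n ->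
    c <= sup [set bregman (block_h_scaled P (block_radius n K)) z x1 | z in K]) ->
  Num.sqrt c <= D_ n K x1.
Proof. by move=> nd H; apply: ler_wsqrtr; apply: Epart_ge. Qed.

(** One of the divergences of [y] and [- y] is at least their average, which is at
least half the squared block norm of [y]. *)
Lemma D_sym_ge n y r : (0 < n <= d)%N ->
  (forall x, K x -> K (- x)) -> K y -> 0 < r ->
  (forall P, P \in equal_partitions d n -> r <= block_norm P y) ->
  r <= 2 * D_ n K x1.
Proof.
move=> nd Ksym Ky r0 H.
have [P0 P0E] : exists P, P \in equal_partitions d n.
  by apply/set0Pn; rewrite -card_gt0 equal_partitions_neq0.
have rad0 : 0 < block_radius n K.
  by apply: lt_le_trans r0 (le_trans (H _ P0E) (block_norm_le_radius P0E Ky)).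
have : Num.sqrt (2^-1 * r ^+ 2) <= D_ n K x1.
  apply: D_ge_sqrt => // P PE.
  have /andP[n0 _] := nd; have [_ cP _] := equal_partitionsP PE.
  have P_gt0 : (0 < #|P|)%N by rewrite cP.
  have := scaled_power_sum_ge rad0 P_gt0 (block_norm_le_radius PE Ky).
  have := bregman_block_sym P y x1 rad0.
  have := bregman_le_sup rad0 PE Ky.
  have := bregman_le_sup rad0 PE (Ksym _ Ky).
  have : r ^+ 2 <= block_norm P y ^+ 2.
    by rewrite lerXn2r ?nnegrE ?block_norm_ge0 ?(ltW r0)//; exact: H.
  lra.
have h : r / 2 <= Num.sqrt (2^-1 * r ^+ 2).
  rewrite -[leLHS]ger0_norm ?divr_ge0 ?(ltW r0)// -sqrtr_sqr; apply: ler_wsqrtr.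
  by rewrite exprMn expr2; have := sqr_ge0 r; lra.
by move=> h2; have := le_trans h h2; lra.
Qed.

End Diameter.

Section SparseGradients.
Variables (R : realType) (d : nat).
Implicit Types (n s : nat) (P : {set {set 'I_d}}) (A : {set 'I_d}) (c : 'rV[R]_d).

Definition support c : {set 'I_d} := [set i : 'I_d | c ord0 i != 0]%SET.

Lemma l2norm_on_le_card A c : (forall i, `|c ord0 i| <= 1) ->
  l2norm_on A c <= Num.sqrt #|A :&: support c|%:R.
Proof.
move=> c1; apply: ler_wsqrtr; rewrite -sumr_const [leRHS]big_mkcond/= big_mkcond/=.
apply: ler_sum => i _; rewrite !inE; case: (i \in A) => //=.
case: eqP => [->|_] /=; first by rewrite expr0n.
by rewrite -real_normK ?num_real// expr_le1.
Qed.

(** A gradient with entries in [[-1, 1]] has squared norm at most its number of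
nonzero entries on each block. *)
Lemma block_dual_norm_sqr_le P c (k : nat) : (forall i, `|c ord0 i| <= 1) ->
  (forall A, A \in P -> #|A :&: support c| <= k)%N ->
  block_dual_norm P c ^+ 2 <= k%:R.
Proof.
move=> c1 H; rewrite -[leRHS](sqr_sqrtr (ler0n R k)) lerXn2r ?nnegrE ?sqrtr_ge0//.
  exact: bigmax_ge_id.
apply: bigmax_le => [|A AP]; first exact: sqrtr_ge0.
by apply: le_trans (l2norm_on_le_card _ c1) _; rewrite ler_wsqrtr// ler_nat H.
Qed.

Lemma block_dual_norm_sqr_le_dim P c : (forall i, `|c ord0 i| <= 1) ->
  block_dual_norm P c ^+ 2 <= d%:R.
Proof.
by move=> c1; apply: block_dual_norm_sqr_le => // A _; rewrite -[leqRHS]card_ord max_card.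
Qed.

Lemma G_ge n s c r : (0 < n <= d)%N -> sparse_unit s c -> 0 <= r ->
  (forall P, P \in equal_partitions d n -> r <= block_dual_norm P c) ->
  r <= G_ (R := R) (d := d) n s.
Proof.
move=> nd cs r0 H.
apply: (@le_trans _ _ (Num.sqrt (Epart n (fun P => block_dual_norm P c ^+ 2)))).
  rewrite -[leLHS]ger0_norm// -sqrtr_sqr; apply: ler_wsqrtr; apply: Epart_ge => // P PE.
  by rewrite lerXn2r ?nnegrE ?bigmax_ge_id// H.
apply: ub_le_sup; last by exists c.
exists (Num.sqrt d%:R) => _ [b [b1 _] <-]; apply: ler_wsqrtr.
by apply: Epart_le => // P _; exact: block_dual_norm_sqr_le_dim.
Qed.

Lemma G_ge1 n s : (0 < n <= d)%N -> (0 < s)%N -> 1 <= G_ (R := R) (d := d) n s.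
Proof.
move=> nd s0; have d0 : (0 < d)%N by lia.
pose i0 : 'I_d := Ordinal d0.
apply: (@G_ge _ _ (delta_mx ord0 i0)) => //.
  split=> [i|]; first by rewrite mxE eqxx/=; case: eqP => _; rewrite ?normr1 ?normr0.
  apply: leq_trans s0; rewrite -[leqRHS](cards1 i0); apply: subset_leq_card.
  by apply/fintype.subsetP => i; rewrite !inE mxE eqxx/=; case: (i == i0); rewrite ?eqxx.
move=> P PE; have [A AP iA] := block_of i0 PE.
apply: le_trans (le_bigmax_cond _
  (fun A => l2norm_on A (delta_mx ord0 i0 : 'rV[R]_d)) AP).
by rewrite l2norm_on_vertex iA.
Qed.

Lemma G_single_ge s : (0 < s <= d)%N -> Num.sqrt s%:R <= G_ (R := R) (d := d) 1 s.
Proof.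
move=> /andP[s0 sd].
pose c : 'rV[R]_d := \row_i (i < s)%:R.
have cardS := card_initial sd.
apply: (@G_ge _ _ c); first by lia.
- split=> [i|]; first by rewrite mxE; case: (i < s)%N; rewrite ?normr1 ?normr0.
  rewrite -[leqRHS]cardS; apply: subset_leq_card; apply/fintype.subsetP => i.
  by rewrite !inE mxE; case: (i < s)%N; rewrite ?eqxx.
- exact: sqrtr_ge0.
move=> P PE; have [_ /eqP/cards1P[A PA] _] := equal_partitionsP PE.
have AP : A \in P by rewrite PA set11.
apply: le_trans (le_bigmax_cond _ (fun A => l2norm_on A c) AP).
have -> : l2norm_on A c = l2norm c.
  by rewrite -(block_norm_single c PE) PA /block_norm big_set1.
apply: ler_wsqrtr.
rewrite -[X in X%:R]cardS -sumr_const big_mkcond/=; apply: ler_sum => i _.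
by rewrite inE mxE; case: (i < s)%N; rewrite ?expr1n ?sqr_ge0.
Qed.

Lemma load_threshold_le s : (0 < s)%N -> (load_threshold s)%:R <= 7 * log_d R s.
Proof.
move=> s0; rewrite /load_threshold natrD.
have L1 := log_d_ge1 R s.
suff : (trunc_log 3 s)%:R <= log_d R s by lra.
apply: (@le_trans _ _ (ln s%:R)); last by rewrite /log_d le_max lexx orbT.
have l3 := ln3_ge1 R.
apply: (@le_trans _ _ (ln (3 ^+ trunc_log 3 s : R))).
  by rewrite lnXn// -[leRHS]mulr_natl ler_peMr.
by rewrite ler_ln ?posrE ?exprn_gt0 ?ltr0n// -natrX ler_nat trunc_logP.
Qed.

(** The squared dual norm is at most the maximal load, and the excess of the load
over [k - 1] averages to at most [1]. *)
Lemma G_matched_le s : (0 < s <= d)%N ->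
  G_ (R := R) (d := d) s s <= Num.sqrt (7 * log_d R s).
Proof.
move=> sd; have /andP[s0 _] := sd.
apply: ge_sup.
  exists (Num.sqrt (Epart s (fun P => block_dual_norm P (0 : 'rV[R]_d) ^+ 2))), 0 => //.
  split=> [i|]; first by rewrite mxE normr0.
  rewrite (_ : [set _ | _]%SET = finset.set0) ?cards0//.
  by apply/setP => i; rewrite !inE mxE eqxx.
move=> _ [c [c1 cs] <-]; apply: ler_wsqrtr.
apply: le_trans (load_threshold_le s0).
set k := load_threshold s; have k0 : (0 < k)%N by rewrite /k /load_threshold addnS.
have N0 := equal_partitions_neq0 sd.
rewrite /Epart ler_pdivrMr ?ltr0n//.
apply: (@le_trans _ _ (\sum_(P in equal_partitions d s)
   (k.-1 + \sum_(A in P) 'C(#|A :&: support c|, k))%:R)).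
  apply: ler_sum => P PE; apply: block_dual_norm_sqr_le => // A AP.
  apply: leq_trans (leq_bin_excess _ k0) _.
  by rewrite leq_add2l (bigD1 A)//= leq_addr.
rewrite -natr_sum -natrM ler_nat big_split/= sum_nat_const.
have := sum_binomial_load sd cs (load_threshold_fact s0); rewrite -/k -/(support c).
case: k k0 => // k _ /=. by rewrite mulSn mulnC addnC leq_add2r.
Qed.

End SparseGradients.

(** * The gain of partitions with as many blocks as the sparsity *)

Section GainBound.
Variables (R : realType) (d : nat) (K : set 'rV[R]_d) (x1 : 'rV[R]_d).

(** All the products have to be positive because the gain divides by their minimum,
and a quotient by [0] is [0]. *)
Lemma gain_ge s n (m u : R) : (0 < n <= d)%N ->
  (forall j, (0 < j <= d)%N -> 0 < D_ j K x1 * G_ (R := R) (d := d) j s) ->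
  0 <= m -> m <= Num.min (D_ 1 K x1 * G_ (R := R) (d := d) 1 s)
                         (D_ d K x1 * G_ (R := R) (d := d) d s) ->
  D_ n K x1 * G_ (R := R) (d := d) n s <= u ->
  m / u <= gain K x1 s.
Proof.
move=> nd pos m0 mle ule; rewrite /gain.
have B0 : 0 < \big[Num.min/D_ 1 K x1 * G_ (R := R) (d := d) 1 s]_(1 <= j < d.+1)
   (D_ j K x1 * G_ (R := R) (d := d) j s).
  rewrite big_nat_cond; apply: lt_bigmin; first by apply: pos; lia.
  by move=> j; rewrite andbT => jd; apply: pos; lia.
apply: ler_pM => //.
  by rewrite invr_ge0; apply: le_trans ule; apply/ltW/pos.
rewrite lef_pV2 ?posrE//; last exact: lt_le_trans (pos _ nd) ule.
apply: le_trans ule.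
apply: (@ge_bigmin_seq _ _ _ _ _ _ _ (fun j => D_ j K x1 * G_ (R := R) (d := d) j s)) => //.
by rewrite mem_index_iota; lia.
Qed.

End GainBound.

Section MatchedPartition.
Variables (R : realType) (d : nat) (K : set 'rV[R]_d) (x1 : 'rV[R]_d).
Variables (M rho r1 r2 : R) (s : nat) (y1 y2 : 'rV[R]_d).
Hypotheses (Kx1 : K x1) (KM : forall x, K x -> l1norm x <= M).
Hypothesis Ksym : forall x, K x -> K (- x).
Hypothesis sd : (0 < s <= d)%N.
Hypotheses (Ky1 : K y1) (r1_gt0 : 0 < r1) (y1_ge : r1 <= l1norm y1).
Hypotheses (Ky2 : K y2) (r2_gt0 : 0 < r2) (y2_ge : r2 <= l2norm y2).
Hypothesis rho_ge : forall P x, P \in equal_partitions d s -> K x ->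
  block_norm P x <= rho.

(** This bounds the diameter away from [0] for every number of blocks at once. *)
Lemma l2norm_le_block_norm n P (x : 'rV[R]_d) : P \in equal_partitions d n ->
  l2norm x <= block_norm P x.
Proof.
move=> PE; rewrite /l2norm -(sum_blocks _ PE).
under eq_bigr do rewrite -sqr_l2norm_on.
by apply: sqrt_sum_sqr_le_sum => A _; exact: l2norm_on_ge0.
Qed.

Lemma matched_D_pos n : (0 < n <= d)%N -> 0 < D_ n K x1.
Proof.
move=> nd; suff : r2 <= 2 * D_ n K x1 by move: r2_gt0; lra.
apply: (D_sym_ge Kx1 KM nd Ksym Ky2 r2_gt0) => P PE.
exact: le_trans y2_ge (l2norm_le_block_norm _ PE).
Qed.

Lemma matched_product_pos n : (0 < n <= d)%N ->
  0 < D_ n K x1 * G_ (R := R) (d := d) n s.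
Proof.
move=> nd; apply: mulr_gt0; first exact: matched_D_pos.
by apply: lt_le_trans ltr01 (G_ge1 _ nd _); case/andP: sd.
Qed.

Lemma euclidean_product_ge :
  r2 * Num.sqrt s%:R / 2 <= D_ 1 K x1 * G_ (R := R) (d := d) 1 s.
Proof.
have d1 : (0 < 1 <= d)%N by case/andP: sd => s0; exact: leq_trans.
have : r2 <= 2 * D_ 1 K x1.
  apply: (D_sym_ge Kx1 KM d1 Ksym Ky2 r2_gt0) => P PE.
  by rewrite block_norm_single.
move=> h; have h' : r2 / 2 <= D_ 1 K x1 by lra.
rewrite mulrAC; apply: ler_pM => //; first by rewrite divr_ge0// ltW.
exact: G_single_ge.
Qed.

Lemma entropic_product_ge : r1 / 2 <= D_ d K x1 * G_ (R := R) (d := d) d s.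
Proof.
have d1 : (0 < d <= d)%N.
  by case/andP: sd => s0 sd'; rewrite leqnn (leq_trans s0 sd').
have : r1 <= 2 * D_ d K x1.
  apply: (D_sym_ge Kx1 KM d1 Ksym Ky1 r1_gt0) => P PE.
  by rewrite block_norm_singletons.
move=> h; have h' : r1 / 2 <= D_ d K x1 by lra.
have G1 : 1 <= G_ (R := R) (d := d) d s by apply: G_ge1 => //; case/andP: sd.
rewrite -[leLHS]mulr1; apply: ler_pM => //.
by rewrite divr_ge0// ltW.
Qed.

Lemma matched_radius_le : 0 < block_radius s K <= rho.
Proof.
have [P0 P0E] : exists P, P \in equal_partitions d s.
  by apply/set0Pn; rewrite -card_gt0 equal_partitions_neq0.
have p0 : 0 < block_norm P0 y2.
  by apply: lt_le_trans r2_gt0 (le_trans y2_ge (l2norm_le_block_norm _ P0E)).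
apply/andP; split; first exact: lt_le_trans p0 (block_norm_le_radius KM P0E Ky2).
apply: (block_radius_le Kx1) => //; apply: le_trans (rho_ge P0E Ky2).
exact: ltW.
Qed.

Lemma matched_product_le :
  D_ s K x1 * G_ (R := R) (d := d) s s <= 7 * rho * log_d R s.
Proof.
have /andP[rad0 radrho] := matched_radius_le.
have L1 := log_d_ge1 R s.
have hD := D_le Kx1 KM rad0; have hG := @G_matched_le R _ _ sd.
apply: (@le_trans _ _ (rho * Num.sqrt (6 * log_d R s) * Num.sqrt (7 * log_d R s))).
  apply: ler_pM => //; first exact: D_ge0.
    by apply: le_trans (G_ge1 R sd _); rewrite ?ler01//; case/andP: sd.
  by apply: le_trans hD _; rewrite ler_wpM2r ?sqrtr_ge0.
have -> : 7 * rho * log_d R s = rho * (7 * log_d R s) by ring.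
rewrite -mulrA ler_wpM2l ?sqrt_logs_le//.
exact: le_trans (ltW rad0) radrho.
Qed.

(** With as many blocks as the sparsity, [D_ s * G_ s] loses only a logarithm
against the radius [rho], while the Euclidean and entropic geometries pay the
full [l2] radius times [sqrt s] and the full [l1] radius. *)
Lemma matched_gain_ge C g : 0 < C ->
  g <= C * (Num.min (r2 * Num.sqrt s%:R) r1 / rho) ->
  tilde_ge (14 * C)^-1 1 (log_d R d) (gain K x1 s) g.
Proof.
move=> C0 gC; rewrite /tilde_ge expr1.
have /andP[rad0 radrho] := matched_radius_le.
have rho0 : 0 < rho by exact: lt_le_trans radrho.
have Ls := log_d_ge1 R s; have Lsd := log_d_le R sd.
have s0 : (0 : R) < Num.sqrt s%:R by rewrite sqrtr_gt0 ltr0n; case/andP: sd.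
set m := Num.min _ _ in gC.
have m0 : 0 < m by rewrite lt_min r1_gt0 mulr_gt0.
have h : (m / 2) / (7 * rho * log_d R s) <= gain K x1 s.
  apply: (gain_ge sd matched_product_pos _ _ matched_product_le).
    by rewrite divr_ge0// ltW.
  rewrite le_min; apply/andP; split.
    apply: le_trans euclidean_product_ge.
    by rewrite ler_pM2r ?invr_gt0// /m ge_min lexx.
  apply: le_trans entropic_product_ge.
  by rewrite ler_pM2r ?invr_gt0// /m ge_min lexx orbT.
apply: le_trans h.
have L0 : 0 < log_d R s by lra.
have Ld0 : 0 < log_d R d by lra.
apply: (@le_trans _ _ ((14 * C)^-1 * (C * (m / rho)) / log_d R d)).
  rewrite ler_pM2r ?invr_gt0// ler_pM2l// invr_gt0; lra.
have -> : (14 * C)^-1 * (C * (m / rho)) / log_d R d = m / (14 * rho) * (log_d R d)^-1.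
  by field; rewrite !gt_eqF.
have -> : m / 2 / (7 * rho * log_d R s) = m / (14 * rho) * (log_d R s)^-1.
  by field; rewrite !gt_eqF.
apply: ler_wpM2l; first by rewrite divr_ge0 ?ltW// mulr_gt0.
by rewrite lef_pV2.
Qed.

End MatchedPartition.

(** * The simplex *)

Section Simplex.
Variables (R : realType) (d : nat).
Hypothesis d3 : (3 <= d)%N.
Implicit Types (n s : nat) (P : {set {set 'I_d}}).

Notation K := (@simplex R d).
Notation x1 := (@simplex_center R d).

Let d_gt0 : (0 : R) < d%:R. Proof. by rewrite ltr0n; lia. Qed.

Lemma simplex_center_in : K x1.
Proof.
split=> [i|]; first by rewrite mxE invr_ge0 ltW.
under eq_bigr do rewrite mxE.
by rewrite sumr_const card_ord -(mulr_natl d%:R^-1) divff// gt_eqF.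
Qed.

Lemma simplex_l1norm x : K x -> l1norm x <= 1.
Proof. by move=> [x0 <-]; apply: ler_sum => i _; rewrite ger0_norm. Qed.

Lemma simplex_vertex_in (i : 'I_d) : K (delta_mx ord0 i).
Proof.
split=> [j|]; first by rewrite mxE eqxx ler0n.
rewrite (bigD1 i)//= mxE !eqxx big1 ?addr0// => j ji.
by rewrite mxE eqxx (negbTE ji).
Qed.

Lemma power_sum_vertex n P (i : 'I_d) (p : R) : p != 0 ->
  P \in equal_partitions d n -> 1 <= power_sum P p (delta_mx ord0 i).
Proof.
move=> p0 PE; have [A AP iA] := block_of i PE.
rewrite /power_sum (bigD1 A)//= l2norm_on_vertex iA powR1 lerDl.
by apply: sumr_ge0 => B _; exact: powR_ge0.
Qed.

Lemma simplex_radius n : (0 < n <= d)%N -> block_radius n K = 1.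
Proof.
move=> nd; apply/eqP; rewrite eq_le; apply/andP; split.
  apply: (block_radius_le simplex_center_in) => // P x PE Kx.
  by apply: le_trans (simplex_l1norm Kx); exact: block_norm_le_l1norm PE.
have [P PE] : exists P, P \in equal_partitions d n.
  by apply/set0Pn; rewrite -card_gt0 equal_partitions_neq0.
have i0 : 'I_d by exists 0%N; lia.
apply: le_trans (block_norm_le_radius simplex_l1norm PE (simplex_vertex_in i0)).
have [A AP iA] := block_of i0 PE.
rewrite /block_norm (bigD1 A)//= l2norm_on_vertex iA lerDl.
by apply: sumr_ge0 => B _; exact: l2norm_on_ge0.
Qed.

(** Each block of the center has norm at most [1 / sqrt d], as it has at most [d]
entries, and these norms add up to at most [1]. *)
Lemma power_sum_center n P (p : R) : 1 < p -> P \in equal_partitions d n ->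
  power_sum P p x1 <= Num.sqrt d%:R^-1 `^ (p - 1).
Proof.
move=> p1 PE; have p0 : 0 < p by exact: lt_trans p1.
set t := Num.sqrt _.
apply: (@le_trans _ _ (t `^ (p - 1) * block_norm P x1)); last first.
  rewrite ler_piMr ?powR_ge0//; apply: le_trans (simplex_l1norm simplex_center_in).
  exact: block_norm_le_l1norm PE.
rewrite /block_norm mulr_sumr; apply: ler_sum => A AP.
rewrite -(mulr_powRB1 (l2norm_on_ge0 _ _) p0) mulrC ler_wpM2r ?l2norm_on_ge0//.
apply: ge0_ler_powR; rewrite ?nnegrE ?l2norm_on_ge0 ?sqrtr_ge0 ?subr_ge0 ?(ltW p1)//.
apply: ler_wsqrtr; under eq_bigr do rewrite mxE.
rewrite sumr_const -(mulr_natl (_ ^+ 2)) expr2 mulrA ler_piMl ?invr_ge0 ?(ltW d_gt0)//.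
by rewrite ler_pdivrMr// mul1r ler_nat -[leqRHS]card_ord max_card.
Qed.

(** The vertices average to the starting point, so the first-order terms of
their divergences cancel on average. *)
Lemma simplex_sup_ge n P : (0 < n <= d)%N -> P \in equal_partitions d n ->
  (gamma_ R n * p_ R n)^-1 * (1 - Num.sqrt d%:R^-1 `^ (p_ R n - 1)) <=
  sup [set bregman (block_h_scaled P (block_radius n K)) z x1 | z in K].
Proof.
move=> nd PE; have [_ cP _] := equal_partitionsP PE.
have p1 := p_gt1 R n; have g0 := gamma_gt0 R n.
have p0 : 0 < p_ R n by exact: lt_trans p1.
have rad0 : 0 < block_radius n K by rewrite simplex_radius.
set S := sup _.
have BS (i : 'I_d) : bregman (block_h_scaled P (block_radius n K)) (delta_mx ord0 i) x1 <= S.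
  by apply: (bregman_le_sup simplex_center_in simplex_l1norm rad0 PE); exact: simplex_vertex_in.
set k := (gamma_ R n * p_ R n)^-1; set t := _ `^ _.
have k0 : 0 <= k by rewrite invr_ge0 mulr_ge0// ltW.
pose gr := gradient (block_h_scaled P (block_radius n K)) x1.
have Blow (i : 'I_d) : k * (1 - t) - dotprod gr (delta_mx ord0 i - x1) <=
    bregman (block_h_scaled P (block_radius n K)) (delta_mx ord0 i) x1.
  rewrite /bregman -/gr lerD2r block_h_scaledE// /scaled_weight simplex_radius// cP.
  rewrite expr1n invr1 powR1 mul1r mulr1 -/k -mulrBr ler_wpM2l//.
  by apply: lerB; [apply: power_sum_vertex PE; rewrite gt_eqF | exact: power_sum_center PE].
have gr0 : \sum_(i < d) dotprod gr (delta_mx ord0 i - x1) = 0.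
  rewrite /dotprod exchange_big big1// => j _; rewrite -mulr_sumr.
  under eq_bigr do rewrite !mxE eqxx/=.
  rewrite big_split/= sumr_const card_ord (bigD1 j)//= eqxx big1; last first.
    by move=> i ij; rewrite eq_sym (negbTE ij).
  by rewrite addr0 mulNrn -(mulr_natl d%:R^-1) divff ?subrr ?mulr0// gt_eqF.
have : \sum_(i < d) (k * (1 - t) - dotprod gr (delta_mx ord0 i - x1)) <= \sum_(i < d) S.
  by apply: ler_sum => i _; exact: le_trans (Blow i) (BS i).
rewrite big_split/= sumrN gr0 oppr0 addr0 !sumr_const card_ord.
by rewrite lerMn2r; case: eqP => //= ?; lia.
Qed.

Lemma sqrt_inv_dim : 0 < Num.sqrt (d%:R^-1 : R) <= 3 / 5.
Proof.
rewrite sqrtr_gt0 invr_gt0 d_gt0/=.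
rewrite -[leRHS]ger0_norm; last by lra.
rewrite -sqrtr_sqr; apply: ler_wsqrtr.
apply: (@le_trans _ _ (3^-1)); last by lra.
by rewrite lef_pV2 ?posrE// ler_nat.
Qed.

Lemma simplex_D_pos n : (0 < n <= d)%N -> 0 < D_ n K x1.
Proof.
move=> nd; apply: lt_le_trans (D_ge_sqrt nd (fun P PE => simplex_sup_ge nd PE)).
have p1 := p_gt1 R n; have g0 := gamma_gt0 R n.
rewrite sqrtr_gt0 mulr_gt0//.
  by rewrite invr_gt0 mulr_gt0// (lt_trans _ p1).
have /andP[t0 t1] := sqrt_inv_dim.
rewrite subr_gt0 /powR gt_eqF// expR_lt1 pmulr_rlt0 ?subr_gt0//.
by apply: ln_lt0; rewrite t0/=; lra.
Qed.

Lemma simplex_D_single : 4^-1 <= D_ 1 K x1.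
Proof.
have d1 : (0 < 1 <= d)%N by lia.
apply: le_trans (D_ge_sqrt d1 (fun P PE => simplex_sup_ge d1 PE)).
have /andP[t0 t1] := sqrt_inv_dim.
rewrite /gamma_ /p_/= (_ : 2 - 1 = 1 :> R); last by lra.
rewrite powRr1 ?(ltW t0)// mul1r -[leLHS]ger0_norm ?invr_ge0// -sqrtr_sqr.
by apply: ler_wsqrtr; rewrite expr2; lra.
Qed.

(** For [d] singletons [p - 1 = 1 / ln d], so the potential of the center is at most
[1 / sqrt e] times that of a vertex, and the latter is of order [ln d]. *)
Lemma simplex_D_singletons : Num.sqrt (ln d%:R) / 2 <= D_ d K x1.
Proof.
have dd : (0 < d <= d)%N by lia.
have l1 : 1 <= ln d%:R :> R by exact: ln_ge1.
apply: le_trans (D_ge_sqrt dd (fun P PE => simplex_sup_ge dd PE)).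
have tE : Num.sqrt (d%:R^-1 : R) `^ (p_ R d - 1) = (expR 2^-1)^-1.
  have p0 : p_ R d - 1 = (ln d%:R)^-1 by rewrite /p_ ifN -?ltnNge// addrC addKr.
  rewrite -powR12_sqrt ?invr_ge0 ?ltW// -powRrM p0 /powR invr_eq0 gt_eqF//.
  rewrite lnV ?posrE// mulrN mulfVK ?gt_eqF ?expRN//; exact: lt_le_trans ltr01 l1.
rewrite tE; set h := expR 2^-1.
have h1 : 3 / 2 <= h by apply: le_trans (expR_ge1Dx _); lra.
have eE : expR 1 = h ^+ 2 :> R.
  by rewrite -expRM_natl; congr expR; rewrite divff.
have p2 := p_le2 R d; have p1 := p_gt1 R d.
have -> : gamma_ R d = (h ^+ 2 * ln d%:R)^-1 by rewrite /gamma_ eE !ifN//; lia.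
have -> : ((h ^+ 2 * ln d%:R)^-1 * p_ R d)^-1 * (1 - h^-1) =
   ln d%:R * (h ^+ 2 - h) / p_ R d.
  by field; rewrite !gt_eqF//; lra.
rewrite -[leLHS]ger0_norm ?divr_ge0 ?sqrtr_ge0// -sqrtr_sqr; apply: ler_wsqrtr.
rewrite exprMn sqr_sqrtr; last by lra.
rewrite ler_pdivlMr; last by lra.
rewrite -mulrA ler_pM2l; last by lra.
have : 3 / 4 <= h ^+ 2 - h by nra.
by rewrite exprVn; lra.
Qed.

Lemma simplex_gain_ge s : (0 < s <= d)%N ->
  28^-1 * (Num.min (Num.sqrt s%:R) (Num.sqrt (ln d%:R)) / log_d R s) <=
  gain K x1 s.
Proof.
move=> sd; have /andP[s0 _] := sd.
have half a b : 0 <= b -> a <= b -> a / 4 <= b / 2 * 1 :> R by move=> *; lra.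
have dd : (0 < d <= d)%N by lia.
have rad := simplex_radius sd.
have rad0 : 0 < block_radius s K by rewrite rad.
have G1 n : (0 < n <= d)%N -> 1 <= G_ (R := R) (d := d) n s.
  by move=> nd; exact: G_ge1.
have pos n : (0 < n <= d)%N -> 0 < D_ n K x1 * G_ (R := R) (d := d) n s.
  move=> nd; apply: mulr_gt0; first exact: simplex_D_pos.
  by apply: lt_le_trans ltr01 (G1 _ nd).
have up : D_ s K x1 * G_ (R := R) (d := d) s s <= 7 * log_d R s.
  apply: le_trans (sqrt_logs_le R s); apply: ler_pM; first exact: D_ge0.
  - by apply: le_trans ler01 (G1 _ sd).
  - by have := D_le simplex_center_in simplex_l1norm rad0; rewrite rad mul1r.
  - exact: G_matched_le.
set m := Num.min _ _.
have m0 : 0 <= m by rewrite le_min !sqrtr_ge0.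
have -> : 28^-1 * (m / log_d R s) = m / 4 / (7 * log_d R s).
  by have := log_d_ge1 R s => L1; field; rewrite gt_eqF//; lra.
apply: (gain_ge sd pos _ _ up); first by rewrite divr_ge0.
rewrite le_min; apply/andP; split.
  have g1 := @G_single_ge R _ _ sd; have d1 := simplex_D_single.
  apply: (@le_trans _ _ (4^-1 * Num.sqrt s%:R)); last by apply: ler_pM; rewrite ?sqrtr_ge0.
  by rewrite mulrC ler_pM2l ?invr_gt0// /m ge_min lexx.
have g1 := G1 _ dd; have d1 := simplex_D_singletons.
apply: (@le_trans _ _ (Num.sqrt (ln d%:R) / 2 * 1)); last first.
  by apply: ler_pM; rewrite ?divr_ge0 ?sqrtr_ge0.
by apply: half; rewrite ?sqrtr_ge0// /m ge_min lexx orbT.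
Qed.

End Simplex.

(** * The lp ball *)

Section VectorNorms.
Variables (R : realType) (d : nat).
Implicit Types (x y w : 'rV[R]_d) (P : {set {set 'I_d}}) (A : {set 'I_d}).

Lemma l2norm_le_entries x y : (forall i, `|x ord0 i| <= `|y ord0 i|) ->
  l2norm x <= l2norm y.
Proof. by move=> xy; exact: sqrt_sum_sqr_le. Qed.

Lemma l2norm_on_le_entries A x y : (forall i, `|x ord0 i| <= `|y ord0 i|) ->
  l2norm_on A x <= l2norm_on A y.
Proof. by move=> xy; exact: sqrt_sum_sqr_le. Qed.

Lemma l1norm_le_entries x y : (forall i, `|x ord0 i| <= `|y ord0 i|) ->
  l1norm x <= l1norm y.
Proof. by move=> xy; apply: ler_sum => i _. Qed.

Lemma block_norm_le_entries P x y : (forall i, `|x ord0 i| <= `|y ord0 i|) ->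
  block_norm P x <= block_norm P y.
Proof. by move=> xy; apply: ler_sum => A _; exact: l2norm_on_le_entries. Qed.

Lemma l1norm_const (a : R) : 0 <= a -> l1norm (const_mx a : 'rV[R]_d) = a * d%:R.
Proof.
move=> a0; rewrite /l1norm; under eq_bigr do rewrite mxE ger0_norm//.
by rewrite sumr_const card_ord mulr_natr.
Qed.

Lemma l2norm_const (a : R) : 0 <= a ->
  l2norm (const_mx a : 'rV[R]_d) = a * Num.sqrt d%:R.
Proof.
move=> a0; rewrite /l2norm; under eq_bigr do rewrite mxE.
by rewrite sumr_const card_ord -(mulr_natr (a ^+ 2)) sqrtrM ?sqr_ge0// sqrtr_sqr ger0_norm.
Qed.

Lemma l2norm_delta (a : R) (i : 'I_d) : 0 <= a ->
  l2norm (a *: delta_mx ord0 i) = a.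
Proof.
move=> a0; rewrite /l2norm (bigD1 i)//= !mxE !eqxx mulr1 big1.
  by rewrite addr0 sqrtr_sqr ger0_norm.
by move=> j ji; rewrite !mxE eqxx (negbTE ji) mulr0 expr0n.
Qed.

Lemma l1norm_ge0 x : 0 <= l1norm x.
Proof. by apply: sumr_ge0. Qed.

Lemma sqr_l2norm x : l2norm x ^+ 2 = \sum_i x ord0 i ^+ 2.
Proof. by rewrite sqr_sqrtr// sumr_ge0// => i _; exact: sqr_ge0. Qed.

Lemma abs_le_l2norm x i : `|x ord0 i| <= l2norm x.
Proof.
rewrite -sqrtr_sqr; apply: ler_wsqrtr; rewrite (bigD1 i)//= lerDl.
by apply: sumr_ge0 => j _; exact: sqr_ge0.
Qed.

Lemma l1normD x y : l1norm (x + y) <= l1norm x + l1norm y.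
Proof.
by rewrite -big_split; apply: ler_sum => i _; rewrite mxE; exact: ler_normD.
Qed.

Lemma l1normZ (a : R) x : l1norm (a *: x) = `|a| * l1norm x.
Proof. by rewrite mulr_sumr; apply: eq_bigr => i _; rewrite mxE normrM. Qed.

Lemma l2normZ (a : R) x : l2norm (a *: x) = `|a| * l2norm x.
Proof.
rewrite /l2norm; under eq_bigr do rewrite mxE exprMn.
by rewrite -mulr_sumr sqrtrM ?sqr_ge0// sqrtr_sqr.
Qed.

Lemma l1norm_le_l2norm x : l1norm x <= Num.sqrt d%:R * l2norm x.
Proof.
have := @sum_mul_le_sqrt R _ xpredT (fun=> 1) (fun i : 'I_d => `|x ord0 i|).
under eq_bigr do rewrite mul1r.
under [X in Num.sqrt X * _]eq_bigr do rewrite expr1n.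
rewrite sumr_const card_ord.
by under [X in _ * Num.sqrt X]eq_bigr do rewrite real_normK ?num_real//.
Qed.

End VectorNorms.

Section LpBall.
Variables (R : realType) (d s : nat) (p : R) (x1 : 'rV[R]_d).
Hypotheses (sd : (0 < s <= d)%N) (p12 : 1 <= p <= 2) (x1K : lp_ball p x1).
Implicit Types (x : 'rV[R]_d) (P : {set {set 'I_d}}) (A : {set 'I_d}).

Let p_gt0 : 0 < p. Proof. by case/andP: p12 => p1 _; exact: lt_le_trans p1. Qed.
Let p_neq0 : p != 0. Proof. by rewrite gt_eqF. Qed.

Lemma lp_ball_entry x i : lp_ball p x -> `|x ord0 i| <= 1.
Proof.
move=> xK; have : `|x ord0 i| `^ p <= 1.
  apply: le_trans xK; rewrite (bigD1 i)//= lerDl.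
  by apply: sumr_ge0 => j _; exact: powR_ge0.
apply: contraTT; rewrite -!ltNge => x_gt1; apply: (lt_le_trans x_gt1).
by apply: le1r_powR; [exact: ltW | case/andP: p12].
Qed.

(** On each block the [l2] norm is at most the [lp] norm, as [p <= 2]. *)
Lemma l2norm_on_powR_le A x :
  l2norm_on A x `^ p <= \sum_(i in A) `|x ord0 i| `^ p.
Proof.
set N := l2norm_on A x.
have [N0|N1] := eqVneq N 0.
  by rewrite N0 powR0// sumr_ge0// => i _; exact: powR_ge0.
have Npos : 0 < N by rewrite lt_neqAle eq_sym N1 l2norm_on_ge0.
have entry i : i \in A -> N `^ p * (x ord0 i ^+ 2 / N ^+ 2) <= `|x ord0 i| `^ p.
  move=> iA.
  have xN : `|x ord0 i| <= N.
    rewrite -sqrtr_sqr; apply: ler_wsqrtr; rewrite (bigD1 i)//= lerDl.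
    by apply: sumr_ge0 => j _; exact: sqr_ge0.
  have [->|xi0] := eqVneq (x ord0 i) 0.
    by rewrite expr0n/= mul0r mulr0 powR_ge0.
  have -> : `|x ord0 i| `^ p = N `^ p * (`|x ord0 i| / N) `^ p.
    by rewrite -powRM ?divr_ge0 ?normr_ge0 ?(ltW Npos)// mulrCA divff ?mulr1.
  rewrite ler_pM2l ?powR_gt0// -exprVn -exprMn -real_normK ?num_real//.
  rewrite normrM normfV (gtr0_norm Npos).
  rewrite -powR_mulrn ?divr_ge0 ?normr_ge0 ?(ltW Npos)//.
  apply: ger_powR; last by case/andP: p12.
  by rewrite divr_gt0 ?normr_gt0//= ler_pdivrMr// mul1r.
apply: (@le_trans _ _ (\sum_(i in A) N `^ p * (x ord0 i ^+ 2 / N ^+ 2))); last first.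
  by apply: ler_sum => i iA; exact: entry.
rewrite -mulr_sumr -mulr_suml -sqr_l2norm_on divff ?mulr1//.
by rewrite expf_eq0.
Qed.

(** The norms of the [s] blocks form a vector in the unit [lp] ball, whose [l1] norm
is at most [s ^ (1 - 1 / p)]. *)
Lemma lp_ball_block_norm P x : P \in equal_partitions d s -> lp_ball p x ->
  block_norm P x <= s%:R `^ (1 - p^-1).
Proof.
move=> PE xK; have [_ cP _] := equal_partitionsP PE.
have s0 : (0 : R) < s%:R by rewrite ltr0n; case/andP: sd.
have /andP[p1 p2] := p12.
have [pE|pne1] := eqVneq p 1.
  rewrite pE invr1 subrr powRr0; apply: le_trans (block_norm_le_l1norm _ PE) _.
  by move: xK; rewrite /lp_ball/= pE; under eq_bigr do rewrite powRr1//.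
have p1s : 1 < p by rewrite lt_neqAle eq_sym pne1.
set T := block_norm P x; have T0 : 0 <= T by exact: block_norm_ge0.
have : s%:R `^ (1 - p) * T `^ p <= 1.
  rewrite -cP; apply: le_trans xK; rewrite -(sum_blocks _ PE).
  apply: (@le_trans _ _ (\sum_(A in P) l2norm_on A x `^ p)).
    apply: power_mean => //; last by rewrite cP; case/andP: sd.
    by move=> A _; exact: l2norm_on_ge0.
  by apply: ler_sum => A _; exact: l2norm_on_powR_le.
rewrite -opprB powRN mulrC ler_pdivrMr ?powR_gt0// mul1r => h.
have : (T `^ p) `^ p^-1 <= (s%:R `^ (p - 1)) `^ p^-1.
  by apply: ge0_ler_powR h; rewrite ?nnegrE ?powR_ge0 ?invr_ge0 ?(ltW p_gt0).
by rewrite -!powRrM divff// powRr1// mulrBl divff// mul1r.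
Qed.

(** The radii are realized by a vertex and by the constant vector. *)
Lemma lp_ball_gain : tilde_ge 14^-1 1 (log_d R d) (gain (lp_ball p) x1 s)
  (Num.min (Num.sqrt s%:R) (d%:R `^ (1 - p^-1)) / s%:R `^ (1 - p^-1)).
Proof.
have /andP[s0 sd'] := sd; have d0 : (0 < d)%N by exact: leq_trans sd'.
have d0R : (0 : R) < d%:R by rewrite ltr0n.
pose i0 : 'I_d := Ordinal d0.
pose y1 : 'rV[R]_d := const_mx (d%:R `^ (- p^-1)).
rewrite -[14]mulr1; apply: (@matched_gain_ge _ _ _ _ d%:R (s%:R `^ (1 - p^-1)) (d%:R `^ (1 - p^-1)) 1 _ y1 (1 *: delta_mx ord0 i0)) => //.
- by move=> x xK; rewrite -[leRHS]mul1r -l1norm_const//; apply: l1norm_le_entries => i;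
    rewrite mxE normr1; exact: lp_ball_entry.
- by move=> x; rewrite /lp_ball/=; under [X in _ -> X <= _]eq_bigr do rewrite mxE normrN.
- rewrite /lp_ball/=; under eq_bigr do rewrite mxE ger0_norm ?powR_ge0//.
  by rewrite sumr_const card_ord -powRrM mulNr mulVf// powR_inv1 ?(ltW d0R)//
    -(mulr_natr (d%:R^-1)) mulVf ?gt_eqF.
- exact: powR_gt0.
- rewrite l1norm_const ?powR_ge0// -{3}(@powRr1 _ d%:R) ?(ltW d0R)// -powRD ?(addrC _ 1)//.
  by apply/implyP => _; rewrite gt_eqF.
- rewrite /lp_ball/= (bigD1 i0)//= !mxE !eqxx mulr1 normr1 powR1 big1 ?addr0// => j ji.
  by rewrite !mxE eqxx (negbTE ji) mulr0 normr0 powR0.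
- by rewrite l2norm_delta.
- by move=> P x; exact: lp_ball_block_norm.
- by rewrite !mul1r.
Qed.

End LpBall.

(** * The ellipsoid and the box *)

Section SortedWeights.
Variable R : realType.

(** With [t] the value at the last index below [s], every term
[(g i - t) * ([i < s] - [i in I])] is nonnegative; sum over [i]. *)
Lemma sum_le_initial d s (g : 'I_d -> R) (I : {set 'I_d}) :
  (0 < s <= d)%N -> (forall i j : 'I_d, (i <= j)%N -> g j <= g i) ->
  (forall i, 0 <= g i) -> (#|I| <= s)%N ->
  \sum_(i in I) g i <= \sum_(i < d | (i < s)%N) g i.
Proof.
move=> /andP[s0 sd] gdec g0 Is.
have s1 : (s.-1 < d)%N by lia.
set t := g (Ordinal s1).
have pt (i : 'I_d) : 0 <= (g i - t) * (((i < s)%N)%:R - (i \in I)%:R).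
  have [is_|si] := ltnP i s.
    apply: mulr_ge0; last by case: (i \in I); rewrite ?subrr ?subr0.
    by rewrite subr_ge0; apply: gdec => /=; lia.
  apply: mulr_le0; last by case: (i \in I); rewrite ?subrr ?sub0r ?oppr_le0.
  by rewrite subr_le0; apply: gdec => /=; lia.
have cI : \sum_(i < d) (i \in I)%:R = #|I|%:R :> R.
  by rewrite -sum1_card natr_sum [RHS]big_mkcond/=; apply: eq_bigr => i _; case: (i \in I).
have : 0 <= \sum_(i < d) (g i - t) * (((i < s)%N)%:R - (i \in I)%:R) by exact: sumr_ge0.
under eq_bigr do rewrite mulrBl.
rewrite sumrB -mulr_sumr sumrB sum_indicator_initial// cI.
under eq_bigr do rewrite mulrBr.
rewrite sumrB.
have -> : \sum_(i < d) g i * ((i < s)%N)%:R = \sum_(i < d | (i < s)%N) g i.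
  by rewrite [RHS]big_mkcond/=; apply: eq_bigr => i _; case: (i < s)%N; rewrite ?mulr1 ?mulr0.
have -> : \sum_(i < d) g i * (i \in I)%:R = \sum_(i in I) g i.
  by rewrite [RHS]big_mkcond/=; apply: eq_bigr => i _; case: (i \in I); rewrite ?mulr1 ?mulr0.
have : 0 <= t * (s%:R - #|I|%:R) by rewrite mulr_ge0 ?g0// subr_ge0 ler_nat.
lra.
Qed.

End SortedWeights.

Section Ellipsoid.
Variables (R : realType) (d s : nat) (w x1 : 'rV[R]_d.+1).
Hypotheses (sd : (0 < s <= d.+1)%N) (wsort : positive_sorted w).
Hypothesis x1K : ellipsoid w x1.
Implicit Types (x : 'rV[R]_d.+1) (P : {set {set 'I_d.+1}}) (A : {set 'I_d.+1}).

Let w_gt0 i : 0 < w ord0 i. Proof. by case: wsort. Qed.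

Lemma ellipsoid_entry x i : ellipsoid w x -> `|x ord0 i| <= `|w ord0 i|.
Proof.
move=> xK; rewrite -ler_sqr ?nnegrE// !real_normK ?num_real//.
rewrite -[leRHS]mul1r -ler_pdivrMr ?exprn_gt0//.
apply: le_trans xK; rewrite (bigD1 i)//= lerDl.
by apply: sumr_ge0 => j _; rewrite divr_ge0 ?sqr_ge0.
Qed.

(** The largest weights of the blocks sit at distinct coordinates, so their
squares sum to at most the [s] largest squared weights. *)
Lemma ellipsoid_block_norm P x : P \in equal_partitions d.+1 s -> ellipsoid w x ->
  block_norm P x <= l2norm (head_part s w).
Proof.
move=> PE xK; have [/and3P[_ /finset.trivIsetP trivP _] cP _] := equal_partitionsP PE.
have [f fP] : exists f : {set 'I_d.+1} -> 'I_d.+1, forall A, A \in P ->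
    f A \in A /\ forall j, j \in A -> w ord0 j <= w ord0 (f A).
  suff : forall A, exists i, A \in P -> i \in A /\ forall j, j \in A -> w ord0 j <= w ord0 i.
    by move=> /choice[f fP]; exists f.
  move=> A; have [AP|] := boolP (A \in P); last by exists ord0.
  have [i0 i0A] : exists i, i \in A by apply/set0Pn; rewrite -card_gt0 (block_neq0 PE AP).
  exists [arg max_(i > i0 in A) w ord0 i]%O => _.
  by case: arg_maxP => // i iA imax; split.
pose u A := Num.sqrt (\sum_(i in A) x ord0 i ^+ 2 / w ord0 i ^+ 2).
have bl A : A \in P -> l2norm_on A x <= w ord0 (f A) * u A.
  move=> AP; have [fA fmax] := fP _ AP.
  rewrite -[X in X * _]ger0_norm ?(ltW (w_gt0 _))// -sqrtr_sqr -sqrtrM ?sqr_ge0//.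
  apply: ler_wsqrtr; rewrite mulr_sumr; apply: ler_sum => i iA.
  rewrite mulrCA ler_peMr ?sqr_ge0// ler_pdivlMr ?exprn_gt0// mul1r.
  by rewrite lerXn2r ?nnegrE ?(ltW (w_gt0 _))// fmax.
apply: (@le_trans _ _ (\sum_(A in P) w ord0 (f A) * u A)); first exact: ler_sum.
apply: le_trans (sum_mul_le_sqrt _ _ _) _.
rewrite -[leRHS]mulr1; apply: ler_pM; rewrite ?sqrtr_ge0//; last first.
  rewrite -[leRHS]sqrtr1; apply: ler_wsqrtr; apply: le_trans xK.
  rewrite -(sum_blocks _ PE); apply: ler_sum => A _.
  by rewrite sqr_sqrtr// sumr_ge0// => i _; rewrite divr_ge0 ?sqr_ge0.
apply: ler_wsqrtr.
have f_inj : {in P &, injective f}.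
  move=> A B AP BP fAB; apply/eqP; apply: contraT => /(trivP _ _ AP BP).
  move/finset.disjoint_setI0 => AB0; have : f A \in A :&: B.
    by rewrite inE (fP _ AP).1 fAB (fP _ BP).1.
  by rewrite AB0 inE.
rewrite -(big_imset (fun i => w ord0 i ^+ 2) f_inj)/=.
apply: le_trans (sum_le_initial (g := fun i => w ord0 i ^+ 2) sd _ _ _) _.
- by move=> i j ij; rewrite lerXn2r ?nnegrE ?(ltW (w_gt0 _))//; apply: (proj2 wsort).
- by move=> i; exact: sqr_ge0.
- by rewrite -cP leq_imset_card.
rewrite big_mkcond/=; apply: ler_sum => i _; rewrite mxE.
by case: ifP => _ //; rewrite expr0n.
Qed.

(** The [l1] radius [l2norm w] is attained at the point with entries
[w i ^ 2 / l2norm w]. *)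
Lemma ellipsoid_gain : tilde_ge 14^-1 1 (log_d R d.+1) (gain (ellipsoid w) x1 s)
  (Num.min (w ord0 ord0 * Num.sqrt s%:R) (l2norm w) / l2norm (head_part s w)).
Proof.
have /andP[s0 sd'] := sd.
have W0 : 0 < l2norm w.
  by apply: lt_le_trans (w_gt0 ord0) (le_trans (ler_norm _) (abs_le_l2norm w ord0)).
pose y1 : 'rV[R]_d.+1 := \row_i (w ord0 i ^+ 2 / l2norm w).
rewrite -[14]mulr1; apply: (@matched_gain_ge _ _ _ _ (l1norm w)
   (l2norm (head_part s w)) (l2norm w) (w ord0 ord0) _ y1
   (w ord0 ord0 *: delta_mx ord0 ord0)) => //.
- by move=> x xK; apply: l1norm_le_entries => i; exact: ellipsoid_entry.
- by move=> x; rewrite /ellipsoid/=; under [X in _ -> X <= _]eq_bigr do rewrite mxE sqrrN.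
- rewrite /ellipsoid/= (eq_bigr (fun i => (l2norm w ^+ 2)^-1 * w ord0 i ^+ 2)).
    by rewrite -mulr_sumr -sqr_l2norm mulVf// expf_eq0/= gt_eqF.
  by move=> i _; rewrite mxE; field; rewrite !gt_eqF.
- rewrite /l1norm (eq_bigr (fun i => (l2norm w)^-1 * w ord0 i ^+ 2)).
    by rewrite -mulr_sumr -sqr_l2norm expr2 mulKf// gt_eqF.
  by move=> i _; rewrite mxE ger0_norm ?divr_ge0 ?sqr_ge0 ?(ltW W0)// mulrC.
- rewrite /ellipsoid/= (bigD1 ord0)//= !mxE !eqxx mulr1 divff ?big1 ?addr0//.
    by move=> j j0; rewrite !mxE eqxx (negbTE j0) mulr0 expr0n/= mul0r.
  by rewrite expf_eq0/= gt_eqF.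
- by rewrite l2norm_delta// ltW.
- by move=> P x; exact: ellipsoid_block_norm.
- by rewrite mul1r.
Qed.

End Ellipsoid.

Section Box.
Variables (R : realType) (d s : nat) (w x1 : 'rV[R]_d).
Hypotheses (sd : (0 < s <= d)%N) (w_gt0 : forall i, 0 < w ord0 i).
Hypothesis x1K : box w x1.
Implicit Types (x : 'rV[R]_d) (P : {set {set 'I_d}}).

(** Bound the block norm by the [l1] norm on the head of [w], and by [sqrt s] times
the [l2] norm on its tail. *)
Lemma box_block_norm P x : P \in equal_partitions d s -> box w x ->
  block_norm P x <= l1norm (head_part s w) + Num.sqrt s%:R * l2norm (tail_part s w).
Proof.
move=> PE xK; apply: (@le_trans _ _ (block_norm P w)).
  by apply: block_norm_le_entries => i; apply: le_trans (xK i) (ler_norm _).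
have {1}-> : w = head_part s w + tail_part s w.
  by apply/rowP => i; rewrite !mxE; case: ifP; rewrite ?addr0 ?add0r.
apply: le_trans (block_normD _ _ _) _; apply: lerD.
  exact: block_norm_le_l1norm PE.
exact: block_norm_le_l2norm PE.
Qed.

Lemma box_norms : [/\ box w w, 0 < l2norm w & 0 < l1norm w].
Proof.
have d0 : (0 < d)%N by move: sd; lia.
have W0 := w_gt0 (Ordinal d0).
have Wl2 := lt_le_trans W0 (le_trans (ler_norm _) (abs_le_l2norm w (Ordinal d0))).
split=> //; first by move=> i; rewrite ger0_norm// ltW.
rewrite /l1norm (bigD1 (Ordinal d0))//= ltr_wpDr//; first exact: sumr_ge0.
by rewrite normr_gt0 gt_eqF.
Qed.

Lemma box_gain : tilde_ge 14^-1 1 (log_d R d) (gain (box w) x1 s)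
  (Num.min (l2norm w * Num.sqrt s%:R) (l1norm w) /
   (l1norm (head_part s w) + Num.sqrt s%:R * l2norm (tail_part s w))).
Proof.
have [wK W2 W1] := box_norms.
rewrite -[14]mulr1; apply: (@matched_gain_ge _ _ _ _ (l1norm w)
   (l1norm (head_part s w) + Num.sqrt s%:R * l2norm (tail_part s w))
   (l1norm w) (l2norm w) _ w w) => //.
- by move=> x xK; apply: l1norm_le_entries => i; apply: le_trans (xK i) (ler_norm _).
- by move=> x xK i; rewrite mxE normrN.
- by move=> P x; exact: box_block_norm.
- by rewrite mul1r.
Qed.

End Box.

(** * Minkowski sums *)

Section MinkowskiSums.
Variables (R : realType) (d s : nat).
Hypothesis sd : (0 < s <= d)%N.
Implicit Types (x y : 'rV[R]_d) (P : {set {set 'I_d}}) (A B : set 'rV[R]_d).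

Let d_gt0 : (0 < d)%N. Proof. by move: sd; lia. Qed.
Let sqrtd_gt0 : (0 : R) < Num.sqrt d%:R. Proof. by rewrite sqrtr_gt0 ltr0n. Qed.

Lemma minkowski_sumN A B : (forall x, A x -> A (- x)) -> (forall x, B x -> B (- x)) ->
  forall x, minkowski_sum A B x -> minkowski_sum A B (- x).
Proof.
move=> AN BN _ [x Ax [y By <-]]; exists (- x); first exact: AN.
by exists (- y); [exact: BN | rewrite opprD].
Qed.

Lemma dilateN (a : R) A : (forall x, A x -> A (- x)) ->
  forall x, dilate a A x -> dilate a A (- x).
Proof. by move=> AN _ [x Ax <-]; exists (- x); [exact: AN | rewrite scalerN]. Qed.

Lemma l1normN x : l1norm (- x) = l1norm x.
Proof. by apply: eq_bigr => i _; rewrite mxE normrN. Qed.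

Lemma l2normN x : l2norm (- x) = l2norm x.
Proof. by rewrite -scaleN1r l2normZ normrN1 mul1r. Qed.

Lemma BinfP x : Binf x <-> forall i, `|x ord0 i| <= 1.
Proof.
split=> [xB i|xB]; last by apply: bigmax_le => // i _.
exact: le_trans (le_bigmax _ (fun i => `|x ord0 i|) i) xB.
Qed.

Lemma BinfN x : Binf x -> Binf (- x).
Proof. by move/BinfP => xB; apply/BinfP => i; rewrite mxE normrN. Qed.

Lemma Binf_l2norm x : Binf x -> l2norm x <= Num.sqrt d%:R.
Proof.
move/BinfP => xB; rewrite -[leRHS]mul1r -l2norm_const//.
by apply: l2norm_le_entries => i; rewrite mxE normr1.
Qed.

Lemma e1E : (e1 : 'rV[R]_d) = delta_mx ord0 (Ordinal d_gt0).
Proof.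
by apply/rowP => i; rewrite !mxE eqxx/= -val_eqE.
Qed.

Lemma l2norm_e1 : l2norm (e1 : 'rV[R]_d) = 1.
Proof. by rewrite e1E -[delta_mx _ _]scale1r l2norm_delta. Qed.

Lemma l1norm_e1 : l1norm (e1 : 'rV[R]_d) = 1.
Proof.
rewrite e1E /l1norm (bigD1 (Ordinal d_gt0))//= mxE !eqxx normr1 big1 ?addr0// => i i0.
by rewrite mxE eqxx (negbTE i0) normr0.
Qed.

Lemma l1norm_spike_flat (a b : R) : 0 <= a -> 0 <= b ->
  l1norm (a *: (e1 : 'rV[R]_d) + const_mx b) = a + b * d%:R.
Proof.
move=> a0 b0.
have -> : a + b * d%:R = a * l1norm (e1 : 'rV[R]_d) + l1norm (const_mx b : 'rV[R]_d).
  by rewrite l1norm_e1 l1norm_const// mulr1.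
rewrite /l1norm mulr_sumr -big_split; apply: eq_bigr => i _; rewrite !mxE.
by rewrite !ger0_norm ?addr_ge0 ?mulr_ge0.
Qed.

(** The same point, a multiple of [e1] plus a constant vector, realizes both radii up
to the factor [2] in the [l2] norm. *)
Lemma l1_linf_gain (a1 ainf : R) x1 : 0 < a1 -> 0 < ainf ->
  minkowski_sum (dilate a1 B1) (dilate ainf Binf) x1 ->
  tilde_ge 28^-1 1 (log_d R d)
    (gain (minkowski_sum (dilate a1 B1) (dilate ainf Binf)) x1 s)
    (Num.min ((a1 + ainf * Num.sqrt d%:R) * Num.sqrt s%:R) (a1 + ainf * d%:R) /
     (a1 + ainf * Num.sqrt (s%:R * d%:R))).
Proof.
move=> a1_gt0 ai_gt0 x1K.
have s0 : (0 : R) < Num.sqrt s%:R by rewrite sqrtr_gt0 ltr0n; case/andP: sd.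
have d0R : (0 : R) < d%:R by rewrite ltr0n.
have rho_gt0 : 0 < a1 + ainf * Num.sqrt (s%:R * d%:R).
  by rewrite ltr_pwDl// mulr_ge0 ?sqrtr_ge0// ltW.
pose y : 'rV[R]_d := a1 *: e1 + const_mx ainf.
have yK : minkowski_sum (dilate a1 B1) (dilate ainf Binf) y.
  exists (a1 *: e1); first by exists e1 => //; rewrite /B1/= l1norm_e1.
  exists (const_mx ainf) => //; exists (const_mx 1); last first.
    by apply/rowP => i; rewrite !mxE mulr1.
  by apply/BinfP => i; rewrite mxE normr1.
pose r2 := (a1 + ainf * Num.sqrt d%:R) / 2.
have r2_gt0 : 0 < r2 by rewrite divr_gt0// addr_gt0// mulr_gt0.
have y2 : r2 <= l2norm y.
  have e0 i : 0 <= (e1 : 'rV[R]_d) ord0 i by rewrite mxE.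
  have h1 : a1 <= l2norm y.
    apply: (@le_trans _ _ (l2norm (a1 *: (e1 : 'rV[R]_d)))).
      by rewrite l2normZ l2norm_e1 mulr1 ler_norm.
    apply: l2norm_le_entries => i; rewrite !mxE.
    by rewrite !ger0_norm ?addr_ge0 ?mulr_ge0 ?(ltW a1_gt0) ?(ltW ai_gt0)// lerDl ltW.
  have h2 : ainf * Num.sqrt d%:R <= l2norm y.
    rewrite -l2norm_const ?(ltW ai_gt0)//; apply: l2norm_le_entries => i; rewrite !mxE.
    by rewrite !ger0_norm ?addr_ge0 ?mulr_ge0 ?(ltW a1_gt0) ?(ltW ai_gt0)// lerDr mulr_ge0// ltW.
  rewrite /r2; move: (l2norm y) (ainf * Num.sqrt d%:R) h1 h2 => Y Z h1 h2; lra.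
rewrite (_ : 28 = 14 * 2); last by ring.
apply: (@matched_gain_ge _ _ _ _ (a1 + ainf * d%:R)
   (a1 + ainf * Num.sqrt (s%:R * d%:R)) (a1 + ainf * d%:R) r2 _ y y) => //.
- move=> _ [_ [u uB <-] [_ [v /BinfP vB <-] <-]].
  apply: le_trans (l1normD _ _) _; rewrite !l1normZ !gtr0_norm//.
  apply: lerD; first by rewrite ler_piMr// ltW.
  rewrite ler_pM2l// -[leRHS]mul1r -l1norm_const//.
  by apply: l1norm_le_entries => i; rewrite mxE normr1.
- apply: minkowski_sumN; apply: dilateN; last exact: BinfN.
  by move=> x; rewrite /B1/= l1normN.
- by rewrite addr_gt0// mulr_gt0.
- by rewrite l1norm_spike_flat ?(ltW a1_gt0) ?(ltW ai_gt0).
- move=> P _ PE [_ [u uB <-] [_ [v vB <-] <-]].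
  apply: le_trans (block_normD _ _ _) _; rewrite !block_normZ !gtr0_norm//.
  apply: lerD.
    by rewrite ler_piMr ?(ltW a1_gt0)//; apply: le_trans uB; exact: block_norm_le_l1norm PE.
  rewrite ler_pM2l// sqrtrM ?ler0n//; apply: le_trans (block_norm_le_l2norm _ PE) _.
  by rewrite ler_pM2l// Binf_l2norm.
rewrite mulrA ler_pM2r ?invr_gt0// /r2.
rewrite minr_pMr; last by lra.
rewrite le_min !ge_min; apply/andP; split; apply/orP; [left|right].
  by rewrite le_eqVlt; apply/orP; left; apply/eqP; field.
by rewrite ler_peMl ?addr_ge0 ?mulr_ge0 ?(ltW a1_gt0) ?(ltW ai_gt0) ?(ltW d0R)//; lra.
Qed.

(** The bodies of the last two kinds lie between a common sum of an [l1] ball and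
an [l2] ball and the two points that realize its radii. *)
Lemma l1_l2_gain (K : set 'rV[R]_d) (a b : R) x1 : 0 < a -> 0 < b ->
  (forall x, K x -> exists u v, [/\ x = a *: u + b *: v, l1norm u <= 1 & l2norm v <= 1]) ->
  (forall x, K x -> K (- x)) ->
  (forall v, l2norm v <= 1 -> K (a *: e1 + b *: v)) -> K x1 ->
  tilde_ge 14^-1 1 (log_d R d) (gain K x1 s)
    (Num.min ((a + b) * Num.sqrt s%:R) (a + b * Num.sqrt d%:R) /
     (a + b * Num.sqrt s%:R)).
Proof.
move=> a_gt0 b_gt0 Ksub KN Ksup x1K.
have s0 : (0 : R) < Num.sqrt s%:R by rewrite sqrtr_gt0 ltr0n; case/andP: sd.
have d0R : (0 : R) < d%:R by rewrite ltr0n.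
have a0 := ltW a_gt0; have b0 := ltW b_gt0.
rewrite -[14]mulr1; apply: (@matched_gain_ge _ _ _ _ (a + b * Num.sqrt d%:R)
   (a + b * Num.sqrt s%:R) (a + b * Num.sqrt d%:R) (a + b) _
   (a *: e1 + b *: const_mx (Num.sqrt d%:R)^-1) (a *: e1 + b *: e1)) => //.
- move=> _ /Ksub[u [v [-> u1 v1]]].
  apply: le_trans (l1normD _ _) _; rewrite !l1normZ !ger0_norm//.
  apply: lerD; first by rewrite ler_piMr.
  rewrite ler_pM2l//; apply: le_trans (l1norm_le_l2norm _) _.
  by rewrite ler_piMr ?sqrtr_ge0.
- apply: Ksup; rewrite l2norm_const ?invr_ge0 ?sqrtr_ge0// mulVf// gt_eqF//.
- by rewrite addr_gt0// mulr_gt0.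
- rewrite (_ : b *: const_mx (Num.sqrt d%:R)^-1 = const_mx (b / Num.sqrt d%:R)); last first.
    by apply/rowP => i; rewrite !mxE.
  rewrite l1norm_spike_flat ?divr_ge0 ?sqrtr_ge0// -mulrA lerD2l ler_pM2l//.
  by rewrite -[X in _ * X](sqr_sqrtr (ltW d0R)) expr2 mulKf// gt_eqF.
- by apply: Ksup; rewrite l2norm_e1.
- by rewrite addr_gt0.
- by rewrite -scalerDl l2normZ l2norm_e1 mulr1 ler_norm.
- move=> P _ PE /Ksub[u [v [-> u1 v1]]].
  apply: le_trans (block_normD _ _ _) _; rewrite !block_normZ !ger0_norm//.
  apply: lerD.
    by rewrite ler_piMr//; apply: le_trans u1; exact: block_norm_le_l1norm PE.
  rewrite ler_pM2l//; apply: le_trans (block_norm_le_l2norm _ PE) _.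
  by rewrite ler_piMr ?sqrtr_ge0.
- by rewrite mul1r.
Qed.

Lemma l1_l2_sum_gain (a1 a2 : R) x1 : 0 < a1 -> 0 < a2 ->
  minkowski_sum (dilate a1 B1) (dilate a2 B2) x1 ->
  tilde_ge 14^-1 1 (log_d R d)
    (gain (minkowski_sum (dilate a1 B1) (dilate a2 B2)) x1 s)
    (Num.min ((a1 + a2) * Num.sqrt s%:R) (a1 + a2 * Num.sqrt d%:R) /
     (a1 + a2 * Num.sqrt s%:R)).
Proof.
move=> a1_gt0 a2_gt0; apply: l1_l2_gain => //.
- by move=> _ [_ [u uB <-] [_ [v vB <-] <-]]; exists u, v.
- apply: minkowski_sumN; apply: dilateN => x; first by rewrite /B1/= l1normN.
  by rewrite /B2/= l2normN.
- move=> v v1; exists (a1 *: e1); first by exists e1 => //; rewrite /B1/= l1norm_e1.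
  by exists (a2 *: v) => //; exists v.
Qed.

Lemma segment_l2_sum_gain (a0 a2 : R) x1 : 0 < a0 -> 0 < a2 ->
  minkowski_sum (dilate a0 segment_e1) (dilate a2 B2) x1 ->
  tilde_ge 14^-1 1 (log_d R d)
    (gain (minkowski_sum (dilate a0 segment_e1) (dilate a2 B2)) x1 s)
    (Num.min ((a0 + a2) * Num.sqrt s%:R) (a0 + a2 * Num.sqrt d%:R) /
     (a0 + a2 * Num.sqrt s%:R)).
Proof.
have segE t : (1 - t) *: (- e1) + t *: e1 = (2 * t - 1) *: e1 :> 'rV[R]_d.
  by rewrite scalerN -scaleNr -scalerDl; congr (_ *: _); ring.
move=> a0_gt0 a2_gt0; apply: l1_l2_gain => //.
- move=> _ [_ [u [t /andP[t0 t1] <-] <-] [_ [v vB <-] <-]].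
  exists ((1 - t) *: - e1 + t *: e1), v; split => //.
  by rewrite segE l1normZ l1norm_e1 mulr1 ler_norml; apply/andP; split; lra.
- apply: minkowski_sumN; apply: dilateN => x; last by rewrite /B2/= l2normN.
  move=> [t /= /andP[t0 t1] <-]; exists (1 - t); first by apply/andP; split; lra.
  by rewrite !segE -scaleNr; congr (_ *: _); ring.
- move=> v v1; exists (a0 *: e1); last by exists (a2 *: v) => //; exists v.
  exists e1 => //; exists 1; first by rewrite /= ler01 lexx.
  by rewrite subrr scale0r add0r scale1r.
Qed.

End MinkowskiSums.

(** * Special families *)

Section DimensionScales.
Variable R : realType.

(** Pass from a bound by the general expression [G] to one by the power of [d] that
it dominates on a special family. *)
Lemma tilde_ge_le (c C : R) (k : nat) (L f G g : R) :
  0 <= c -> 0 < C -> 1 <= L -> g <= C * G ->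
  tilde_ge c k L f G -> tilde_ge (c / C) k L f g.
Proof.
move=> c0 C0 L1 gG; apply: le_trans.
have Lk : 0 < L ^+ k by rewrite exprn_gt0// (lt_le_trans ltr01).
rewrite ler_pM2r ?invr_gt0// -mulrA ler_wpM2l//.
by rewrite mulrC ler_pdivrMr// mulrC.
Qed.

Variable d : nat.
Hypothesis d_gt0 : (0 < d)%N.
Let q : R := d%:R `^ (1 / 4).
Let s : nat := floor_sqrt R d.

Lemma quarter_ge1 : 1 <= q.
Proof.
by rewrite /q -[leLHS](powRr0 (d%:R : R)) ler_powR ?ler1n//; lra.
Qed.

Lemma quarter_pow4 : d%:R = q ^+ 4.
Proof.
rewrite /q -powR_mulrn ?powR_ge0// -powRrM (_ : 1 / 4 * 4%:R = 1) ?powRr1//.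
by field.
Qed.

Lemma powR_neg_quarter : d%:R `^ (- (1 / 4)) = q^-1.
Proof. by rewrite powRN. Qed.

Lemma powR_neg_half : d%:R `^ (- (1 / 2)) = (q ^+ 2)^-1.
Proof.
rewrite powRN /q -powR_mulrn ?powR_ge0// -powRrM; congr ((_ `^ _)^-1).
by field.
Qed.

Lemma sqrt_dim : Num.sqrt d%:R = q ^+ 2.
Proof.
have q1 := quarter_ge1.
rewrite quarter_pow4 (_ : q ^+ 4 = (q ^+ 2) ^+ 2); last by rewrite -exprM.
by rewrite sqrtr_sqr ger0_norm// sqr_ge0.
Qed.

Lemma floor_sqrt_bounds : [/\ (0 < s <= d)%N, q ^+ 2 / 2 <= s%:R & s%:R <= q ^+ 2].
Proof.
have q1 := quarter_ge1; have q2 : 1 <= q ^+ 2 by rewrite expr2; nra.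
have := @truncn_itv _ (Num.sqrt d%:R : R) (sqrtr_ge0 _).
rewrite -/(floor_sqrt R d) -/s sqrt_dim => /andP[sle slt].
have s0 : (0 < s)%N by rewrite -ltnS -(ltr_nat R); apply: le_lt_trans slt.
have s1 : 1 <= s%:R :> R by rewrite ler1n.
split => //; last by move: slt; rewrite -natr1; lra.
rewrite s0 -(ler_nat R); apply: le_trans sle _.
have q4 : q ^+ 4 = q ^+ 2 * q ^+ 2 by rewrite -exprD.
by rewrite quarter_pow4 q4 ler_peMl// (le_trans ler01).
Qed.

Lemma sqrt_floor_sqrt : q / 2 <= Num.sqrt s%:R <= q.
Proof.
have q1 := quarter_ge1; have [_ h1 h2] := floor_sqrt_bounds.
have q0 : 0 <= q by exact: le_trans ler01 q1.
apply/andP; split; last first.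
  by rewrite -[leRHS]ger0_norm// -sqrtr_sqr; apply: ler_wsqrtr.
rewrite -[leLHS]ger0_norm ?divr_ge0// -sqrtr_sqr; apply: ler_wsqrtr.
apply: le_trans h1; rewrite exprMn; have := sqr_ge0 q.
by move: (q ^+ 2) => Q Q0; rewrite expr2; lra.
Qed.

Lemma lp_ball_special : d%:R `^ (1 / 8) <= 2 *
  (Num.min (Num.sqrt s%:R) (d%:R `^ (1 - (4 / 3)^-1)) / s%:R `^ (1 - (4 / 3)^-1)) :> R.
Proof.
have q1 := quarter_ge1; have [/andP[s0 _] h1 h2] := floor_sqrt_bounds.
have /andP[g1 g2] := sqrt_floor_sqrt.
have q0 : 0 < q by exact: lt_le_trans ltr01 q1.
have -> : 1 - (4 / 3)^-1 = 1 / 4 :> R by field.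
have -> : d%:R `^ (1 / 8) = Num.sqrt q.
  by rewrite -powR12_sqrt ?(ltW q0)// -powRrM; congr (_ `^ _); field.
have -> : s%:R `^ (1 / 4) = Num.sqrt (Num.sqrt s%:R) :> R.
  rewrite -powR12_sqrt ?sqrtr_ge0// -powR12_sqrt ?ler0n// -powRrM.
  by congr (_ `^ _); field.
have z0 : 0 < Num.sqrt (Num.sqrt s%:R) :> R by rewrite !sqrtr_gt0 ltr0n.
have zq : Num.sqrt (Num.sqrt s%:R) <= Num.sqrt q by exact: ler_wsqrtr.
have qq : Num.sqrt q * Num.sqrt q = q by rewrite -expr2 sqr_sqrtr// ltW.
rewrite mulrA ler_pdivlMr//.
apply: (@le_trans _ _ (Num.sqrt q * Num.sqrt q)); first by rewrite ler_wpM2l ?sqrtr_ge0.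
rewrite qq -ler_pdivrMl// le_min -/q.
by apply/andP; split; [rewrite mulrC | lra].
Qed.

Lemma sum_indicator_first : \sum_(i < d) ((i : nat) == 0%N)%:R = 1 :> R.
Proof.
rewrite (bigD1 (Ordinal d_gt0))//= big1 ?addr0// => i i0.
by rewrite -val_eqE in i0; rewrite (negbTE i0).
Qed.

(** Compare [f] with [u * [i = 0] + v * [i < s]]. *)
Lemma sum_spike_initial (f : 'I_d -> R) (u v : R) : 0 <= v ->
  (forall i : 'I_d, (i : nat) = 0%N -> f i <= u) ->
  (forall i : 'I_d, (0 < i < s)%N -> f i <= v) ->
  (forall i : 'I_d, (s <= i)%N -> f i <= 0) -> 
  \sum_i f i <= u + s%:R * v.
Proof.
move=> v0 f0 f1 f2; have [/andP[s0 sd] _ _] := floor_sqrt_bounds.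
apply: (@le_trans _ _ (\sum_(i < d) (((i : nat) == 0%N)%:R * u + (i < s)%N%:R * v))).
  apply: ler_sum => i _; have [i0|i0] := eqVneq (i : nat) 0%N.
    by rewrite i0 s0/= !mul1r (le_trans (f0 _ i0))// lerDl.
  have [is_|si] := ltnP i s.
    by rewrite /= mul0r add0r mul1r f1// lt0n i0.
  by rewrite /= !mul0r addr0 f2.
by rewrite big_split/= -!mulr_suml sum_indicator_first sum_indicator_initial// mul1r.
Qed.

End DimensionScales.

(** In every special family the numerator [m] is of order [1] and the denominator [h]
of order [1 / q]. *)
Lemma ratio_ge (R : realType) (q m h A B : R) : 0 < q -> 0 < A -> 0 < h ->
  A <= m -> h <= B * q^-1 -> q <= B / A * (m / h).
Proof.
move=> q0 A0 h0 Am hB.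
have B0 : 0 < B by rewrite -(pmulr_lgt0 B (_ : 0 < q^-1)) ?invr_gt0// (lt_le_trans h0).
apply: (@le_trans _ _ (B / h)).
  by rewrite ler_pdivlMr// mulrC -ler_pdivlMr.
rewrite (_ : B / A * (m / h) = B / h * (m / A)); last by field; rewrite !gt_eqF.
by rewrite ler_peMr ?divr_ge0 ?(ltW B0) ?(ltW h0)// ler_pdivlMr// mul1r.
Qed.

Section SpecialFamilies.
Variables (R : realType) (d : nat) (a b : R).
Hypotheses (d_gt0 : (0 < d)%N) (a_gt0 : 0 < a) (b_gt0 : 0 < b).
Let q : R := d%:R `^ (1 / 4).
Let s : nat := floor_sqrt R d.

Let q_ge1 : 1 <= q. Proof. exact: quarter_ge1. Qed.
Let q_gt0 : 0 < q. Proof. exact: lt_le_trans ltr01 q_ge1. Qed.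
Let V_gt0 n : 0 < (q ^+ n)^-1. Proof. by rewrite invr_gt0 exprn_gt0. Qed.
Let Vq_gt0 : 0 < q^-1. Proof. by rewrite invr_gt0. Qed.
Let V_le n m : (m <= n)%N -> (q ^+ n)^-1 <= (q ^+ m)^-1.
Proof. by move=> mn; rewrite lef_pV2 ?posrE ?exprn_gt0// ler_weXn2l. Qed.

(** A point of [l2] norm of order [1 / q] already makes the Euclidean product of
order [1], since [sqrt s] is of order [q]. *)
Lemma spike_ge (u : R) : a * q^-1 <= u -> a / 2 <= u * Num.sqrt s%:R.
Proof.
move=> hu; have /andP[g1 _] := sqrt_floor_sqrt R d_gt0.
apply: (@le_trans _ _ (a * q^-1 * (q / 2))).
  by rewrite le_eqVlt; apply/orP; left; apply/eqP; field; rewrite gt_eqF.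
by apply: ler_pM => //; rewrite ?mulr_ge0 ?invr_ge0// ltW.
Qed.

Let s_le : s%:R * (b * (q ^+ 4)^-1) <= b * (q ^+ 2)^-1.
Proof.
have [_ _ h2] := floor_sqrt_bounds R d_gt0.
rewrite (_ : b * (q ^+ 2)^-1 = q ^+ 2 * (b * (q ^+ 4)^-1)); last first.
  by field; rewrite gt_eqF.
by rewrite ler_wpM2r// mulr_ge0 ?ltW.
Qed.

Section Spiked.
Variables (m : nat) (w : 'rV[R]_d).
Hypotheses (m_ge1 : (1 <= m)%N)
  (w0 : forall i : 'I_d, (i : nat) = 0%N -> comparable_with a b (w ord0 i) q^-1)
  (wj : forall i : 'I_d, (0 < i)%N -> comparable_with a b (w ord0 i) (q ^+ m)^-1).

Lemma spiked_ge i : a * (q ^+ m)^-1 <= w ord0 i.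
Proof.
have [i0|i0] := eqVneq (i : nat) 0%N; last first.
  by rewrite -lt0n in i0; have /andP[] := wj i0.
have /andP[h _] := w0 i0; apply: le_trans h.
by rewrite ler_pM2l// -[in leRHS](expr1 q) V_le.
Qed.

Lemma spiked_gt0 i : 0 < w ord0 i.
Proof. by apply: lt_le_trans (spiked_ge i); rewrite mulr_gt0. Qed.

Lemma spiked_first_ge : a * q^-1 <= w ord0 (Ordinal d_gt0).
Proof. by have /andP[] := w0 (erefl : (Ordinal d_gt0 : nat) = 0%N). Qed.

Lemma spiked_l2norm_ge : a / 2 <= l2norm w * Num.sqrt s%:R.
Proof.
apply: spike_ge; apply: le_trans spiked_first_ge _.
by apply: le_trans (ler_norm _) (abs_le_l2norm _ _).
Qed.

Lemma head_part_gt0 : 0 < l2norm (head_part s w).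
Proof.
have [/andP[s0 _] _ _] := floor_sqrt_bounds R d_gt0.
apply: lt_le_trans (abs_le_l2norm _ (Ordinal d_gt0)).
by rewrite mxE/= s0 normr_gt0 gt_eqF// spiked_gt0.
Qed.

End Spiked.

Lemma ellipsoid_special (w : 'rV[R]_d) (i0 : 'I_d) : (i0 : nat) = 0%N ->
  (forall i : 'I_d, (i : nat) = 0%N -> comparable_with a b (w ord0 i) q^-1) ->
  (forall i : 'I_d, (0 < i)%N -> comparable_with a b (w ord0 i) (q ^+ 2)^-1) ->
  q <= 2 * b / (a / 2) *
    (Num.min (w ord0 i0 * Num.sqrt s%:R) (l2norm w) / l2norm (head_part s w)).
Proof.
move=> i00 w0 wj; have w_gt0 := spiked_gt0 (isT : (1 <= 2)%N) w0 wj.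
have w_ge := spiked_ge (isT : (1 <= 2)%N) w0 wj.
apply: ratio_ge => //; first by rewrite divr_gt0.
- exact: head_part_gt0 wj.
- rewrite le_min; apply/andP; split.
    by apply: spike_ge; have /andP[] := w0 _ i00.
  apply: (@le_trans _ _ (l2norm (const_mx (a * (q ^+ 2)^-1) : 'rV[R]_d))).
    rewrite l2norm_const ?mulr_ge0 ?(ltW a_gt0) ?(ltW (V_gt0 _))//.
    rewrite sqrt_dim// -/q mulfVK ?gt_eqF ?exprn_gt0//.
    by have := a_gt0; lra.
  apply: l2norm_le_entries => i; rewrite mxE !gtr0_norm ?mulr_gt0//.
have b2 : 0 <= b ^+ 2 by exact: sqr_ge0.
rewrite -[leRHS]ger0_norm ?mulr_ge0 ?(ltW b_gt0) ?(ltW Vq_gt0)// -sqrtr_sqr.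
apply: ler_wsqrtr.
apply: (@le_trans _ _ (b ^+ 2 * (q ^+ 2)^-1 + s%:R * (b ^+ 2 * (q ^+ 4)^-1))).
  have [/andP[s0 _] _ _] := floor_sqrt_bounds R d_gt0.
  apply: sum_spike_initial => //; first by rewrite mulr_ge0// ltW.
  - move=> i iz; rewrite mxE -/s iz s0 -exprVn -exprMn.
    have /andP[_ h] := w0 _ iz; rewrite lerXn2r ?nnegrE ?(ltW (w_gt0 _))//.
    by rewrite mulr_ge0 ?(ltW b_gt0) ?(ltW Vq_gt0).
  - move=> i /andP[iz is_]; rewrite mxE -/s is_ (_ : q ^+ 4 = (q ^+ 2) ^+ 2); last by rewrite -exprM.
    rewrite -exprVn -exprMn.
    have /andP[_ h] := wj _ iz; rewrite lerXn2r ?nnegrE ?(ltW (w_gt0 _))//.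
    by rewrite mulr_ge0 ?(ltW b_gt0) ?(ltW (V_gt0 _)).
  - by move=> i si; rewrite mxE ltnNge si/= expr0n.
have [_ _ h2] := floor_sqrt_bounds R d_gt0.
apply: (@le_trans _ _ (b ^+ 2 * (q ^+ 2)^-1 + q ^+ 2 * (b ^+ 2 * (q ^+ 4)^-1))).
  by rewrite lerD2l ler_wpM2r// mulr_ge0// ltW.
have -> : q ^+ 2 * (b ^+ 2 * (q ^+ 4)^-1) = b ^+ 2 * (q ^+ 2)^-1.
  by field; rewrite gt_eqF.
rewrite !exprMn exprVn -mulrA.
have : 0 <= b ^+ 2 * (q ^+ 2)^-1 by rewrite mulr_ge0// ltW.
by move: (b ^+ 2 * (q ^+ 2)^-1) => Z Z0; lra.
Qed.

Section SpikedBox.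
Variable w : 'rV[R]_d.
Hypotheses
  (w0 : forall i : 'I_d, (i : nat) = 0%N -> comparable_with a b (w ord0 i) q^-1)
  (wj : forall i : 'I_d, (0 < i)%N -> comparable_with a b (w ord0 i) (q ^+ 4)^-1).

Lemma spiked_box_l1norm_ge : a / 2 <= l1norm w.
Proof.
apply: (@le_trans _ _ (l1norm (const_mx (a * (q ^+ 4)^-1) : 'rV[R]_d))).
  rewrite l1norm_const ?mulr_ge0 ?(ltW a_gt0) ?(ltW (V_gt0 _))//.
  rewrite [d%:R]quarter_pow4 -/q mulfVK ?gt_eqF ?exprn_gt0//.
  by have := a_gt0; lra.
apply: l1norm_le_entries => i; have w_gt := spiked_gt0 (isT : (1 <= 4)%N) w0 wj.
by rewrite mxE !gtr0_norm ?mulr_gt0// (spiked_ge (isT : (1 <= 4)%N) w0 wj).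
Qed.

Lemma spiked_box_radius_le :
  l1norm (head_part s w) + Num.sqrt s%:R * l2norm (tail_part s w) <= 3 * b * q^-1.
Proof.
have w_gt0 := spiked_gt0 (isT : (1 <= 4)%N) w0 wj.
have [/andP[s0 _] _ _] := floor_sqrt_bounds R d_gt0.
have /andP[_ g2] := sqrt_floor_sqrt R d_gt0.
have h1 : l1norm (head_part s w) <= b * q^-1 + b * q^-1.
  apply: (@le_trans _ _ (b * q^-1 + s%:R * (b * (q ^+ 4)^-1))); last first.
    rewrite lerD2l; apply: le_trans s_le _; rewrite ler_pM2l//.
    by rewrite -[in leRHS](expr1 q) V_le.
  apply: sum_spike_initial => //; first by rewrite mulr_ge0 ?(ltW b_gt0) ?(ltW (V_gt0 _)).
  - by move=> i iz; rewrite mxE -/s iz s0 gtr0_norm//; have /andP[] := w0 iz.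
  - by move=> i /andP[iz is_]; rewrite mxE -/s is_ gtr0_norm//; have /andP[] := wj iz.
  - by move=> i si; rewrite mxE ltnNge si/= normr0.
have h2 : l2norm (tail_part s w) <= b * (q ^+ 2)^-1.
  apply: (@le_trans _ _ (l2norm (const_mx (b * (q ^+ 4)^-1) : 'rV[R]_d))).
    apply: l2norm_le_entries => i; rewrite !mxE [leRHS]gtr0_norm ?mulr_gt0//.
    case: ltnP => si; first by rewrite normr0 mulr_ge0 ?(ltW b_gt0) ?(ltW (V_gt0 _)).
    by rewrite gtr0_norm//; have /andP[] := wj (leq_trans s0 si).
  rewrite l2norm_const ?mulr_ge0 ?(ltW b_gt0) ?(ltW (V_gt0 _))// sqrt_dim// -/q.
  by rewrite le_eqVlt; apply/orP; left; apply/eqP; field; rewrite gt_eqF.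
have h3 : Num.sqrt s%:R * l2norm (tail_part s w) <= b * q^-1.
  apply: (@le_trans _ _ (q * (b * (q ^+ 2)^-1))).
    by apply: ler_pM; rewrite ?sqrtr_ge0.
  by rewrite le_eqVlt; apply/orP; left; apply/eqP; field; rewrite gt_eqF.
by apply: le_trans (lerD h1 h3) _; rewrite -mulrA; move: (b * q^-1) => Z; lra.
Qed.

End SpikedBox.

End SpecialFamilies.

Section SumSpecialFamilies.
Variables (R : realType) (d : nat) (a b : R).
Hypotheses (d_gt0 : (0 < d)%N) (a_gt0 : 0 < a) (b_gt0 : 0 < b).
Let q : R := d%:R `^ (1 / 4).
Let s : nat := floor_sqrt R d.

Let q_ge1 : 1 <= q. Proof. exact: quarter_ge1. Qed.
Let q_gt0 : 0 < q. Proof. exact: lt_le_trans ltr01 q_ge1. Qed.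
Let d_gt0R : (0 : R) < d%:R. Proof. by rewrite ltr0n. Qed.
Let sqrts_gt0 : (0 : R) < Num.sqrt s%:R.
Proof.
by have [/andP[s0 _] _ _] := floor_sqrt_bounds R d_gt0; rewrite sqrtr_gt0 ltr0n.
Qed.

Lemma l1_linf_special (a1 ainf : R) : 0 < a1 -> 0 < ainf ->
  comparable_with a b a1 q^-1 -> comparable_with a b ainf d%:R^-1 ->
  q <= 2 * b / (a / 2) *
    (Num.min ((a1 + ainf * Num.sqrt d%:R) * Num.sqrt s%:R) (a1 + ainf * d%:R) /
     (a1 + ainf * Num.sqrt (s%:R * d%:R))).
Proof.
move=> a1_gt0 ai_gt0 /andP[l1 u1] /andP[l2 u2].
have /andP[_ g2] := sqrt_floor_sqrt R d_gt0.
have hs := sqrtr_ge0 (d%:R : R); have hsd := sqrtr_ge0 (s%:R * d%:R : R).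
apply: ratio_ge => //; first by rewrite divr_gt0.
- by rewrite ltr_pwDl// mulr_ge0// ltW.
- rewrite le_min; apply/andP; split.
    apply: le_trans (spike_ge d_gt0 a_gt0 l1) _.
    by rewrite ler_wpM2r ?(ltW sqrts_gt0)// lerDl mulr_ge0// ltW.
  apply: (@le_trans _ _ (ainf * d%:R)); last by rewrite lerDr ltW.
  apply: (@le_trans _ _ (a * d%:R^-1 * d%:R)); last by rewrite ler_pM2r.
  by rewrite mulfVK ?gt_eqF//; have := a_gt0; lra.
rewrite -mulrA (_ : 2 * (b * q^-1) = b * q^-1 + b * q^-1); last by ring.
apply: lerD => //.
apply: (@le_trans _ _ (b * d%:R^-1 * (q * q ^+ 2))).
  apply: ler_pM => //; first exact: ltW.
  rewrite sqrtrM ?ler0n// [Num.sqrt d%:R]sqrt_dim// -/q.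
  by rewrite ler_wpM2r// exprn_ge0// ltW.
rewrite quarter_pow4 -/q le_eqVlt; apply/orP; left; apply/eqP; field.
by rewrite gt_eqF.
Qed.

Lemma l1_l2_special (a1 a2 : R) : 0 < a1 -> 0 < a2 ->
  comparable_with a b a1 q^-1 -> comparable_with a b a2 (q ^+ 2)^-1 ->
  q <= 2 * b / (a / 2) *
    (Num.min ((a1 + a2) * Num.sqrt s%:R) (a1 + a2 * Num.sqrt d%:R) /
     (a1 + a2 * Num.sqrt s%:R)).
Proof.
move=> a1_gt0 a2_gt0 /andP[l1 u1] /andP[l2 u2].
have /andP[_ g2] := sqrt_floor_sqrt R d_gt0.
have q2 : 0 < q ^+ 2 by rewrite exprn_gt0.
apply: ratio_ge => //; first by rewrite divr_gt0.
- by rewrite addr_gt0// mulr_gt0.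
- rewrite le_min; apply/andP; split.
    apply: le_trans (spike_ge d_gt0 a_gt0 l1) _.
    by rewrite ler_wpM2r ?(ltW sqrts_gt0)// lerDl ltW.
  rewrite sqrt_dim// -/q.
  apply: (@le_trans _ _ (a2 * q ^+ 2)); last by rewrite lerDr ltW.
  apply: (@le_trans _ _ (a * (q ^+ 2)^-1 * q ^+ 2)); last by rewrite ler_pM2r.
  by rewrite mulfVK ?gt_eqF//; have := a_gt0; lra.
rewrite -mulrA (_ : 2 * (b * q^-1) = b * q^-1 + b * q^-1); last by ring.
apply: lerD => //.
apply: (@le_trans _ _ (b * (q ^+ 2)^-1 * q)).
  by apply: ler_pM => //; rewrite ltW.
by rewrite le_eqVlt; apply/orP; left; apply/eqP; field; rewrite gt_eqF.
Qed.

End SumSpecialFamilies.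

(** * Regret bounds for spiked boxes *)

Section BoxSet.
Variables (R : realType) (d : nat) (w : 'rV[R]_d).

Lemma box_bounded : bounded_set (box w).
Proof.
exists (l1norm w); split; first exact: num_real.
move=> M /ltW wM x xK /=; apply: le_trans wM.
rewrite /Num.norm/= mx_normrE; apply: bigmax_le => [|[i j] _]; first exact: l1norm_ge0.
rewrite /= (ord1 i); apply: le_trans (xK j) _; apply: le_trans (ler_norm _) _.
by rewrite /l1norm (bigD1 j)//= lerDl sumr_ge0.
Qed.

Lemma box_convex : convex_set (box w).
Proof.
move=> x y t /set_mem xK /set_mem yK; apply/mem_set => i.
have -> : conv t x y ord0 i = t%:num * x ord0 i + (1 - t%:num) * y ord0 i.
  by rewrite /conv/= !mxE.
have t0 : 0 <= t%:num by []. have t1 : 0 <= 1 - t%:num by rewrite subr_ge0.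
apply: le_trans (ler_normD _ _) _; rewrite !normrM (ger0_norm t0) (ger0_norm t1).
apply: (@le_trans _ _ (t%:num * w ord0 i + (1 - t%:num) * w ord0 i)).
  by apply: lerD; apply: ler_wpM2l.
by rewrite -mulrDl addrC subrK mul1r.
Qed.

End BoxSet.

Section SpikedBoxRegret.
Variables (R : realType) (d : nat).
Hypothesis d_gt0 : (0 < d)%N.
Let q : R := d%:R `^ (1 / 4).
Let s : nat := floor_sqrt R d.

Definition spiked_weights (e : nat) : 'rV[R]_e :=
  \row_i (if (i : nat) == 0%N then e%:R `^ (- (1 / 4)) else e%:R^-1).

Let w := spiked_weights d.

Let w0 (i : 'I_d) : (i : nat) = 0%N -> comparable_with 1 1 (w ord0 i) q^-1.
Proof. by move=> i0; rewrite /comparable_with mxE i0 eqxx powR_neg_quarter !(mul1r q^-1) lexx. Qed.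

Let wj (i : 'I_d) : (0 < i)%N -> comparable_with 1 1 (w ord0 i) (q ^+ 4)^-1.
Proof.
rewrite lt0n => i0; rewrite /comparable_with mxE (negbTE i0).
by rewrite (quarter_pow4 R d) !(mul1r (q ^+ 4)^-1) lexx.
Qed.

(** Both competitors have a product of at least [1 / 4], while the matched partition
has a product of order [log_d d / q]. *)
Lemma spiked_box_regret x1 : box w x1 ->
  [/\ 0 < D_ s (box w) x1 * G_ (R := R) (d := d) s s,
      D_ s (box w) x1 * G_ (R := R) (d := d) s s <=
        84 * log_d R d * (q^-1 * (D_ 1 (box w) x1 * G_ (R := R) (d := d) 1 s)) &
      D_ s (box w) x1 * G_ (R := R) (d := d) s s <=
        84 * log_d R d * (q^-1 * (D_ d (box w) x1 * G_ (R := R) (d := d) d s))].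
Proof.
have half4 X : 1 / 2 <= X -> 4^-1 <= X / 2 :> R by move=> *; lra.
move=> x1K; have [sd _ _] := floor_sqrt_bounds R d_gt0.
have w_gt0 := spiked_gt0 d_gt0 ltr01 (isT : (1 <= 4)%N) w0 wj.
have [wK W2 W1] := box_norms sd w_gt0.
have KM x : box w x -> l1norm x <= l1norm w.
  by move=> xK; apply: l1norm_le_entries => i; apply: le_trans (xK i) (ler_norm _).
have KN x : box w x -> box w (- x) by move=> xK i; rewrite mxE normrN.
have Krho P x : P \in equal_partitions d s -> box w x ->
    block_norm P x <= l1norm (head_part s w) + Num.sqrt s%:R * l2norm (tail_part s w).
  exact: box_block_norm.
have q1 : 1 <= q := quarter_ge1 R d_gt0.
have q0 : 0 < q^-1 by rewrite invr_gt0 (lt_le_trans ltr01).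
have up : D_ s (box w) x1 * G_ (R := R) (d := d) s s <= 21 * log_d R d * q^-1.
  apply: le_trans (matched_product_le x1K KM sd wK W2 (lexx _) Krho) _.
  have hrho := spiked_box_radius_le d_gt0 ltr01 ltr01 w0 wj.
  have hL := log_d_le R sd; have L1 := log_d_ge1 R s.
  apply: (@le_trans _ _ (7 * (3 * 1 * q^-1) * log_d R s)).
    by rewrite ler_wpM2r ?ler_pM2l// (le_trans ler01).
  rewrite (_ : 7 * (3 * 1 * q^-1) * log_d R s = 21 * q^-1 * log_d R s); last by ring.
  by rewrite mulrAC ler_wpM2r ?(ltW q0)// ler_pM2l.
have e1_ : 4^-1 <= D_ 1 (box w) x1 * G_ (R := R) (d := d) 1 s.
  apply: le_trans (euclidean_product_ge x1K KM KN sd wK W2 (lexx _)).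
  by apply: half4; exact: (spiked_l2norm_ge (a := 1) (b := 1) d_gt0 ltr01 w0).
have e2_ : 4^-1 <= D_ d (box w) x1 * G_ (R := R) (d := d) d s.
  apply: le_trans (entropic_product_ge x1K KM KN sd wK W1 (lexx _)).
  by apply: half4; exact: (spiked_box_l1norm_ge (a := 1) (b := 1) d_gt0 ltr01 w0 wj).
have fin Y : 4^-1 <= Y -> D_ s (box w) x1 * G_ (R := R) (d := d) s s <=
    84 * log_d R d * (q^-1 * Y).
  move=> Y4; apply: le_trans up _.
  have -> : 84 * log_d R d * (q^-1 * Y) = 21 * log_d R d * q^-1 * (4 * Y) by ring.
  have L1 := log_d_ge1 R d.
  rewrite ler_peMr//; last by rewrite -ler_pdivrMl// mulr1.
  by rewrite !mulr_ge0 ?(ltW q0)// (le_trans ler01).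
split; [|exact: fin|exact: fin].
exact: (matched_product_pos x1K KM KN sd wK W2 (lexx _) sd).
Qed.

End SpikedBoxRegret.

Section SimplexStatements.
Variable R : realType.

Lemma log_d_ln n : (3 <= n)%N -> log_d R n = ln n%:R.
Proof. by move=> n3; apply/max_r/ln_ge1. Qed.

Lemma simplex_special d : (1 <= floor_ln R d <= d)%N ->
  tilde_ge 56^-1 1 (loglog_d R d)
    (gain (@simplex R d) (@simplex_center R d) (floor_ln R d)) (Num.sqrt (ln d%:R)).
Proof.
set s := floor_ln R d => sd; have /andP[s0 s_d] := sd.
have l0 : 0 <= ln d%:R :> R by rewrite ln_ge0// ler1n; lia.
have /andP[h1 h2] := truncn_itv l0; rewrite -/(floor_ln R d) -/s in h1 h2.
have s1 : 1 <= s%:R :> R by rewrite ler1n.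
have d3 : (3 <= d)%N.
  rewrite leqNgt; apply/negP => d2.
  have d_le : d%:R <= 2 :> R by rewrite ler_nat.
  have e2 := @expR_gt1Dx R 1 (oner_neq0 _).
  have : ln d%:R < 1 :> R.
    rewrite -[ltRHS]expRK ltr_ln ?posrE ?expR_gt0// ?ltr0n; [lra | lia].
  lra.
have := simplex_gain_ge R d3 sd; rewrite /tilde_ge expr1; apply: le_trans.
have LL : log_d R s <= loglog_d R d.
  rewrite /log_d /loglog_d ge_max le_max lexx/= le_max ler_ln ?posrE ?h1 ?orbT//; lra.
have L1 := log_d_ge1 R s.
have hm : Num.sqrt (ln d%:R) / 2 <= Num.min (Num.sqrt s%:R) (Num.sqrt (ln d%:R)) :> R.
  rewrite le_min; apply/andP; split; last by have := sqrtr_ge0 (ln d%:R : R); lra.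
  rewrite -[leLHS]ger0_norm ?divr_ge0 ?sqrtr_ge0// -sqrtr_sqr; apply: ler_wsqrtr.
  by rewrite exprMn sqr_sqrtr// expr2; move: h2; rewrite -natr1; lra.
rewrite mulrA; apply: ler_pM.
- by rewrite mulr_ge0 ?sqrtr_ge0.
- by rewrite invr_ge0 (le_trans _ LL)// (le_trans ler01).
- by lra.
- by rewrite lef_pV2 ?posrE//; lra.
Qed.

End SimplexStatements.

Theorem theorem1 (R : realType) :
  (* (1) probability simplex *)
  ((exists (c : R) (k : nat), 0 < c /\
     forall d s : nat, (3 <= s <= d)%N ->
       tilde_ge c k (loglog_d R d)
         (gain (@simplex R d) simplex_center s)
         (Num.min (Num.sqrt s%:R) (Num.sqrt (ln d%:R)) / ln s%:R)) /\
   (exists (c : R) (k : nat), 0 < c /\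
     forall d : nat, (1 <= floor_ln R d <= d)%N ->
       tilde_ge c k (loglog_d R d)
         (gain (@simplex R d) simplex_center (floor_ln R d))
         (Num.sqrt (ln d%:R)))) /\
  (* (2) L_p ball *)
  ((exists (c : R) (k : nat), 0 < c /\
     forall (d s : nat) (p : R) (x1 : 'rV[R]_d),
       (3 <= s <= d)%N -> 1 <= p <= 2 -> x1 \in lp_ball p ->
       tilde_ge c k (log_d R d)
         (gain (lp_ball p) x1 s)
         (Num.min (Num.sqrt s%:R) (d%:R `^ (1 - p^-1)) /
          s%:R `^ (1 - p^-1))) /\
   (exists (c : R) (k : nat), 0 < c /\
     forall (d : nat) (x1 : 'rV[R]_d),
       (1 <= d)%N -> x1 \in lp_ball (4 / 3) ->
       tilde_ge c k (log_d R d)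
         (gain (lp_ball (4 / 3)) x1 (floor_sqrt R d))
         (d%:R `^ (1 / 8)))) /\
  (* (3) axis-aligned ellipsoid *)
  ((exists (c : R) (k : nat), 0 < c /\
     forall (d s : nat) (w x1 : 'rV[R]_d.+1),
       (3 <= s <= d.+1)%N -> positive_sorted w -> x1 \in ellipsoid w ->
       tilde_ge c k (log_d R d.+1)
         (gain (ellipsoid w) x1 s)
         (Num.min (w ord0 ord0 * Num.sqrt s%:R) (l2norm w) /
          l2norm (head_part s w))) /\
   (forall a b : R, 0 < a -> 0 < b ->
     exists (c : R) (k : nat), 0 < c /\
     forall (d : nat) (w x1 : 'rV[R]_d.+1),
       positive_sorted w ->
       comparable_with a b (w ord0 ord0) (d.+1%:R `^ (- (1 / 4))) ->
       (forall j : 'I_d.+1, (0 < j)%N ->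
          comparable_with a b (w ord0 j) (d.+1%:R `^ (- (1 / 2)))) ->
       x1 \in ellipsoid w ->
       tilde_ge c k (log_d R d.+1)
         (gain (ellipsoid w) x1 (floor_sqrt R d.+1))
         (d.+1%:R `^ (1 / 4)))) /\
  (* (4) box *)
  ((exists (c : R) (k : nat), 0 < c /\
     forall (d s : nat) (w x1 : 'rV[R]_d),
       (3 <= s <= d)%N -> positive_sorted w -> x1 \in box w ->
       tilde_ge c k (log_d R d)
         (gain (box w) x1 s)
         (Num.min (l2norm w * Num.sqrt s%:R) (l1norm w) /
          (l1norm (head_part s w) +
           Num.sqrt s%:R * l2norm (tail_part s w)))) /\
   (forall a b : R, 0 < a -> 0 < b ->
     exists (c : R) (k : nat), 0 < c /\
     forall (d : nat) (w x1 : 'rV[R]_d.+1),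
       positive_sorted w ->
       comparable_with a b (w ord0 ord0) (d.+1%:R `^ (- (1 / 4))) ->
       (forall j : 'I_d.+1, (0 < j)%N ->
          comparable_with a b (w ord0 j) (d.+1%:R^-1)) ->
       x1 \in box w ->
       tilde_ge c k (log_d R d.+1)
         (gain (box w) x1 (floor_sqrt R d.+1))
         (d.+1%:R `^ (1 / 4)))) /\
  (* (5) sum of L_1 and L_infinity balls *)
  ((exists (c : R) (k : nat), 0 < c /\
     forall (d s : nat) (a1 ainf : R) (x1 : 'rV[R]_d),
       (3 <= s <= d)%N -> 0 < a1 -> 0 < ainf ->
       x1 \in minkowski_sum (dilate a1 B1) (dilate ainf Binf) ->
       tilde_ge c k (log_d R d)
         (gain (minkowski_sum (dilate a1 B1) (dilate ainf Binf)) x1 s)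
         (Num.min ((a1 + ainf * Num.sqrt d%:R) * Num.sqrt s%:R)
                  (a1 + ainf * d%:R) /
          (a1 + ainf * Num.sqrt (s%:R * d%:R)))) /\
   (forall a b : R, 0 < a -> 0 < b ->
     exists (c : R) (k : nat), 0 < c /\
     forall (d : nat) (a1 ainf : R) (x1 : 'rV[R]_d),
       (1 <= d)%N -> 0 < a1 -> 0 < ainf ->
       comparable_with a b a1 (d%:R `^ (- (1 / 4))) ->
       comparable_with a b ainf (d%:R^-1) ->
       x1 \in minkowski_sum (dilate a1 B1) (dilate ainf Binf) ->
       tilde_ge c k (log_d R d)
         (gain (minkowski_sum (dilate a1 B1) (dilate ainf Binf)) x1
            (floor_sqrt R d))
         (d%:R `^ (1 / 4)))) /\
  (* (6) sum of L_1 and L_2 balls *)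
  ((exists (c : R) (k : nat), 0 < c /\
     forall (d s : nat) (a1 a2 : R) (x1 : 'rV[R]_d),
       (3 <= s <= d)%N -> 0 < a1 -> 0 < a2 ->
       x1 \in minkowski_sum (dilate a1 B1) (dilate a2 B2) ->
       tilde_ge c k (log_d R d)
         (gain (minkowski_sum (dilate a1 B1) (dilate a2 B2)) x1 s)
         (Num.min ((a1 + a2) * Num.sqrt s%:R) (a1 + a2 * Num.sqrt d%:R) /
          (a1 + a2 * Num.sqrt s%:R))) /\
   (forall a b : R, 0 < a -> 0 < b ->
     exists (c : R) (k : nat), 0 < c /\
     forall (d : nat) (a1 a2 : R) (x1 : 'rV[R]_d),
       (1 <= d)%N -> 0 < a1 -> 0 < a2 ->
       comparable_with a b a1 (d%:R `^ (- (1 / 4))) ->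
       comparable_with a b a2 (d%:R `^ (- (1 / 2))) ->
       x1 \in minkowski_sum (dilate a1 B1) (dilate a2 B2) ->
       tilde_ge c k (log_d R d)
         (gain (minkowski_sum (dilate a1 B1) (dilate a2 B2)) x1
            (floor_sqrt R d))
         (d%:R `^ (1 / 4)))) /\
  (* (7) segment plus L_2 ball *)
  ((exists (c : R) (k : nat), 0 < c /\
     forall (d s : nat) (a0 a2 : R) (x1 : 'rV[R]_d),
       (3 <= s <= d)%N -> 0 < a0 -> 0 < a2 ->
       x1 \in minkowski_sum (dilate a0 segment_e1) (dilate a2 B2) ->
       tilde_ge c k (log_d R d)
         (gain (minkowski_sum (dilate a0 segment_e1) (dilate a2 B2)) x1 s)
         (Num.min ((a0 + a2) * Num.sqrt s%:R) (a0 + a2 * Num.sqrt d%:R) /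
          (a0 + a2 * Num.sqrt s%:R))) /\
   (forall a b : R, 0 < a -> 0 < b ->
     exists (c : R) (k : nat), 0 < c /\
     forall (d : nat) (a0 a2 : R) (x1 : 'rV[R]_d),
       (1 <= d)%N -> 0 < a0 -> 0 < a2 ->
       comparable_with a b a0 (d%:R `^ (- (1 / 4))) ->
       comparable_with a b a2 (d%:R `^ (- (1 / 2))) ->
       x1 \in minkowski_sum (dilate a0 segment_e1) (dilate a2 B2) ->
       tilde_ge c k (log_d R d)
         (gain (minkowski_sum (dilate a0 segment_e1) (dilate a2 B2)) x1
            (floor_sqrt R d))
         (d%:R `^ (1 / 4)))) /\
  (* consequence for the regret upper bounds *)
  (exists (K : forall d : nat, set 'rV[R]_d) (s n : nat -> nat)
          (C : R) (k : nat),
     0 < C /\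
     forall d : nat, (1 <= d)%N ->
       bounded_set (K d) /\ convex_set (K d) /\ K d !=set0 /\
       (1 <= s d <= d)%N /\ (1 <= n d <= d)%N /\
       forall (x1 : 'rV[R]_d) (T : nat), x1 \in K d -> (1 <= T)%N ->
         0 < regret_bound (n d) (K d) x1 (s d) T /\
         tilde_le C k (log_d R d)
           (regret_bound (n d) (K d) x1 (s d) T)
           (d%:R `^ (- (1 / 4)) * regret_bound 1 (K d) x1 (s d) T) /\
         tilde_le C k (log_d R d)
           (regret_bound (n d) (K d) x1 (s d) T)
           (d%:R `^ (- (1 / 4)) * regret_bound d (K d) x1 (s d) T)).
Proof.
split.
  split; last by exists 56^-1, 1%N; split=> // d; exact: simplex_special.
  exists 28^-1, 0%N; split=> // d s /andP[s3 sd].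
  have d3 : (3 <= d)%N by exact: leq_trans sd.
  rewrite /tilde_ge expr0 divr1 -(log_d_ln R s3).
  by apply: simplex_gain_ge => //; lia.
split.
  split.
    exists 14^-1, 1%N; split=> // d s p x1 sd p12 /set_mem x1K.
    by apply: lp_ball_gain => //; lia.
  exists (14^-1 / 2), 1%N; split; first by rewrite divr_gt0.
  move=> d x1 d0 /set_mem x1K; have [sd _ _] := floor_sqrt_bounds R d0.
  apply: tilde_ge_le (lp_ball_gain sd _ x1K) => //; first exact: log_d_ge1.
    exact: lp_ball_special.
  by apply/andP; split; lra.
split.
  split.
    exists 14^-1, 1%N; split=> // d s w x1 sd wsort /set_mem x1K.
    by apply: ellipsoid_gain => //; lia.
  move=> a b a0 b0; exists (14^-1 / (2 * b / (a / 2))), 1%N.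
  have C0 : 0 < 2 * b / (a / 2) by rewrite !divr_gt0// mulr_gt0.
  split; first by rewrite divr_gt0.
  move=> d w x1 wsort w0 wj /set_mem x1K; have [sd _ _] := floor_sqrt_bounds R (ltn0Sn d).
  apply: tilde_ge_le (ellipsoid_gain sd wsort x1K) => //; first exact: log_d_ge1.
  apply: ellipsoid_special => // i iz.
    by rewrite (_ : i = ord0) -?powR_neg_quarter//; exact: val_inj.
  by rewrite -powR_neg_half; exact: wj.
split.
  split.
    exists 14^-1, 1%N; split=> // d s w x1 sd [w_gt0 _] /set_mem x1K.
    by apply: box_gain => //; lia.
  move=> a b a0 b0; exists (14^-1 / (3 * b / (a / 2))), 1%N.
  have C0 : 0 < 3 * b / (a / 2) by rewrite !divr_gt0// mulr_gt0.
  split; first by rewrite divr_gt0.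
  move=> d w x1 [w_gt0 _] w0 wj /set_mem x1K; have [sd _ _] := floor_sqrt_bounds R (ltn0Sn d).
  apply: tilde_ge_le (box_gain sd w_gt0 x1K) => //; first exact: log_d_ge1.
  have w0' (i : 'I_d.+1) : (i : nat) = 0%N ->
      comparable_with a b (w ord0 i) (d.+1%:R `^ (1 / 4))^-1.
    by move=> iz; rewrite (_ : i = ord0) -?powR_neg_quarter//; exact: val_inj.
  have wj' (i : 'I_d.+1) : (0 < i)%N ->
      comparable_with a b (w ord0 i) ((d.+1%:R `^ (1 / 4)) ^+ 4)^-1.
    by move=> iz; rewrite -quarter_pow4; exact: wj.
  have d0 := ltn0Sn d; have q1 := quarter_ge1 R d0.
  apply: ratio_ge.
  - exact: lt_le_trans ltr01 q1.
  - by rewrite divr_gt0.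
  - rewrite ltr_pwDl ?mulr_ge0 ?sqrtr_ge0//.
    apply: lt_le_trans (head_part_gt0 d0 a0 (isT : (1 <= 4)%N) w0' wj') _.
    by rewrite /l2norm /l1norm; under eq_bigr do rewrite -real_normK ?num_real//;
      exact: sqrt_sum_sqr_le_sum.
  - rewrite le_min (spiked_l2norm_ge d0 a0 w0').
    exact: (spiked_box_l1norm_ge d0 a0 w0' wj').
  - exact: (spiked_box_radius_le d0 a0 b0 w0' wj').
split.
  split.
    exists 28^-1, 1%N; split=> // d s a1 ainf x1 sd a1_gt0 ai_gt0 /set_mem x1K.
    by apply: l1_linf_gain => //; lia.
  move=> a b a0 b0; exists (28^-1 / (2 * b / (a / 2))), 1%N.
  have C0 : 0 < 2 * b / (a / 2) by rewrite !divr_gt0// mulr_gt0.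
  split; first by rewrite divr_gt0.
  move=> d a1 ainf x1 d0 a1_gt0 ai_gt0 h1 h2 /set_mem x1K.
  have [sd _ _] := floor_sqrt_bounds R d0.
  apply: tilde_ge_le (l1_linf_gain sd a1_gt0 ai_gt0 x1K) => //; first exact: log_d_ge1.
  by apply: l1_linf_special => //; rewrite -powR_neg_quarter.
split.
  split.
    exists 14^-1, 1%N; split=> // d s a1 a2 x1 sd a1_gt0 a2_gt0 /set_mem x1K.
    by apply: l1_l2_sum_gain => //; lia.
  move=> a b a0 b0; exists (14^-1 / (2 * b / (a / 2))), 1%N.
  have C0 : 0 < 2 * b / (a / 2) by rewrite !divr_gt0// mulr_gt0.
  split; first by rewrite divr_gt0.
  move=> d a1 a2 x1 d0 a1_gt0 a2_gt0 h1 h2 /set_mem x1K.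
  have [sd _ _] := floor_sqrt_bounds R d0.
  apply: tilde_ge_le (l1_l2_sum_gain sd a1_gt0 a2_gt0 x1K) => //; first exact: log_d_ge1.
  by apply: l1_l2_special => //; rewrite -?powR_neg_quarter -?powR_neg_half.
split.
  split.
    exists 14^-1, 1%N; split=> // d s a1 a2 x1 sd a1_gt0 a2_gt0 /set_mem x1K.
    by apply: segment_l2_sum_gain => //; lia.
  move=> a b a0 b0; exists (14^-1 / (2 * b / (a / 2))), 1%N.
  have C0 : 0 < 2 * b / (a / 2) by rewrite !divr_gt0// mulr_gt0.
  split; first by rewrite divr_gt0.
  move=> d a1 a2 x1 d0 a1_gt0 a2_gt0 h1 h2 /set_mem x1K.
  have [sd _ _] := floor_sqrt_bounds R d0.
  apply: tilde_ge_le (segment_l2_sum_gain sd a1_gt0 a2_gt0 x1K) => //; first exact: log_d_ge1.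
  by apply: l1_l2_special => //; rewrite -?powR_neg_quarter -?powR_neg_half.
exists (fun d => box (spiked_weights R d)), (floor_sqrt R), (floor_sqrt R), 84, 1%N.
split=> // d d0; have [sd _ _] := floor_sqrt_bounds R d0.
split; first exact: box_bounded.
split; first exact: box_convex.
split; first by exists 0 => i; rewrite !mxE normr0; case: ifP; rewrite ?powR_ge0 ?invr_ge0 ?ler0n.
do 2!split => //.
move=> x1 T /set_mem x1K T0; have [pos le1 led] := spiked_box_regret d0 x1K.
have T_gt0 : 0 < 2 * Num.sqrt (T%:R : R) by rewrite mulr_gt0// sqrtr_gt0 ltr0n.
have rE n : regret_bound n (box (spiked_weights R d)) x1 (floor_sqrt R d) T =
    2 * Num.sqrt T%:R * (D_ n (box (spiked_weights R d)) x1 *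
      G_ (R := R) (d := d) n (floor_sqrt R d)).
  by rewrite /regret_bound; ring.
rewrite /tilde_le !rE expr1 powR_neg_quarter; split; first exact: mulr_gt0.
have assoc (A q X Y : R) : A * (q * (X * Y)) = X * (A * (q * Y)) by ring.
by split; rewrite assoc ler_pM2l.
Qed.
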